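(* Let $S\in\mathcal S_d(\mathcal U,\mathcal Y)$ and let $(C,\mathbf A)$, with $C\in\mathcal L(\mathcal X,\mathcal Y)$ and $\mathbf A=(A_1,\dots,A_d)\in\mathcal L(\mathcal X)^d$, be a contractive pair such that $K_S(\lambda,\zeta)=K_{C,\mathbf A}(\lambda,\zeta)$ for all $\lambda,\zeta\in\mathbb B^d$. Let $\mathcal D$, $C_V$, $T_{11},T_{12},T_{22}$, $G_1$, $G_2$ and $\mathcal U_S^0$ be the spaces and operators associated with $S$ and $(C,\mathbf A)$ as defined in the context. Then: (1) A realization $\mathbf U=\begin{bmatrix}A&B\\ C&S(0)\end{bmatrix}$ of $S$ is weakly coisometric if and only if $B$ is of the form $$B=\begin{bmatrix}X^*\\ C_V^*\end{bmatrix}:\mathcal U\to\begin{bmatrix}\mathcal D^\perp\\ \mathcal D\end{bmatrix}\cong\mathcal X^d,\qquad X=-G_2T_{12}^*G_1^*+Q(I_{\mathcal D^\perp}-G_1G_1^* )^{1/2},\qquad(\ast)$$ where $Q:\overline{\operatorname{Ran}}\,(I_{\mathcal D^\perp}-G_1G_1^* )^{1/2}\to\mathcal U_S^0$ is a contraction. (2) $S$ admits a coisometric realization of the form $\mathbf U=\begin{bmatrix}A&B\\ C&S(0)\end{bmatrix}$ (for some $B:\mathcal U\to\mathcal X^d$) if and only if $$\dim\overline{\operatorname{Ran}}\,(I_{\mathcal D^\perp}-G_1G_1^* )^{1/2}\le\dim\mathcal U_S^0 .$$ In this case, a realization $\mathbf U=\begin{bmatrix}A&B\\ C&S(0)\end{bmatrix}$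 of $S$ is coisometric if and only if $B$ is of the form $(\ast)$ for some isometric $Q:\overline{\operatorname{Ran}}\,(I_{\mathcal D^\perp}-G_1G_1^* )^{1/2}\to\mathcal U_S^0$. (3) $S$ admits a unitary realization of the form $\mathbf U=\begin{bmatrix}A&B\\ C&S(0)\end{bmatrix}$ (for some $B:\mathcal U\to\mathcal X^d$) if and only if $(C,\mathbf A)$ is an isometric pair, i.e. $A_1^*A_1+\cdots+A_d^*A_d+C^*C=I_{\mathcal X}$, and $$\dim(\operatorname{Ker}A^*\cap\mathcal D^\perp)=\dim\mathcal U_S^0 .$$ In this case, a realization $\mathbf U=\begin{bmatrix}A&B\\ C&S(0)\end{bmatrix}$ of $S$ is unitary if and only if $B$ is of the form $(\ast)$ for some unitary $Q:\overline{\operatorname{Ran}}\,(I_{\mathcal D^\perp}-G_1G_1^* )^{1/2}\to\mathcal U_S^0$.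
   Context: $\mathcal U,\mathcal Y,\mathcal X$ are Hilbert spaces and $\mathcal L(\cdot,\cdot)$ denotes bounded linear operators. $\mathbb B^d$ is the open unit ball of $\mathbb C^d$ with inner product $\langle\lambda,\zeta\rangle=\sum_j\lambda_j\overline{\zeta_j}$; $\mathcal H(k_d)$ is the reproducing kernel Hilbert space on $\mathbb B^d$ with kernel $k_d(\lambda,\zeta)=1/(1-\langle\lambda,\zeta\rangle)$ and $\mathcal H_{\mathcal Y}(k_d)=\mathcal H(k_d)\otimes\mathcal Y$, viewed as a space of $\mathcal Y$-valued functions. $\mathcal S_d(\mathcal U,\mathcal Y)$ is the set of $\mathcal L(\mathcal U,\mathcal Y)$-valued analytic functions $S$ on $\mathbb B^d$ such that $f\mapsto S f$ is a contraction from $\mathcal H_{\mathcal U}(k_d)$ into $\mathcal H_{\mathcal Y}(k_d)$. Put $K_S(\lambda,\zeta)=\dfrac{I_{\mathcal Y}-S(\lambda)S(\zeta)^*}{1-\langle\lambda,\zeta\rangle}$. The pair $(C,\mathbf A)$ is contractive if $A_1^*A_1+\cdots+A_d^*A_d+C^*C\le I_{\mathcal X}$. Put $$K_{C,\mathbf A}(\lambda,\zeta)=C(I-\lambda_1A_1-\cdots-\lambda_dA_d)^{-1}(I-\overline{\zeta_1}A_1^*-\cdots-\overline{\zeta_d}A_d^* )^{-1}C^* .$$ $A:\mathcal X\to\mathcal X^d$ and $B:\mathcal U\to\mathcal X^d$ are columns with entries $A_j$ and $B_j\in\mathcal L(\mathcal U,\mathcal X)$, and $Z(\lambda)=[\lambda_1I_{\mathcal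 X}\ \cdots\ \lambda_dI_{\mathcal X}]:\mathcal X^d\to\mathcal X$. An operator $\mathbf U=\begin{bmatrix}A&B\\ C&D\end{bmatrix}:\mathcal X\oplus\mathcal U\to\mathcal X^d\oplus\mathcal Y$ is a realization of $S$ if $S(\lambda)=D+C(I-Z(\lambda)A)^{-1}Z(\lambda)B$ on $\mathbb B^d$. Let $$\mathcal D=\overline{\operatorname{span}}\{Z(\zeta)^*(I-A^*Z(\zeta)^* )^{-1}C^*y:\ \zeta\in\mathbb B^d,\ y\in\mathcal Y\}\subset\mathcal X^d,\qquad \mathcal D^\perp=\mathcal X^d\ominus\mathcal D .$$ The realization is coisometric (unitary) if $\mathbf U$ is; it is weakly coisometric if $\mathbf U^*:\mathcal X^d\oplus\mathcal Y\to\mathcal X\oplus\mathcal U$ is contractive and is isometric on $\mathcal D\oplus\mathcal Y$. Associated objects (given $K_S=K_{C,\mathbf A}$): - $C_V:\mathcal D\to\mathcal U$ is the bounded operator determined by linearity and continuity from $C_V:\ Z(\zeta)^*(I-A^*Z(\zeta)^* )^{-1}C^*y\mapsto(S(\zeta)^*-S(0)^* )y$ (well defined because $K_S=K_{C,\mathbf A}$; moreover $\begin{bmatrix}A^*|_{\mathcal D}&C^*\\ C_V&S(0)^*\end{bmatrix}:\mathcal D\oplus\mathcal Y\to\mathcal X\oplus\mathcal U$ is then isometric). - $T_{11}=A^*|_{\mathcal D^\perp}:\mathcal D^\perp\to\mathcal X$, $T_{12}=[A^*|_{\mathcal D}\ \ C^*]:\mathcal D\oplus\mathcal Y\to\mathcal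 X$, $T_{22}=[C_V\ \ S(0)^*]:\mathcal D\oplus\mathcal Y\to\mathcal U$. - $G_1:\overline{\operatorname{Ran}}\,(I-T_{12}T_{12}^* )^{1/2}\to\mathcal D^\perp$ is the unique (contractive) operator with $G_1(I-T_{12}T_{12}^* )^{1/2}=T_{11}^*$ (and $\operatorname{Ker}G_1^*=\operatorname{Ker}T_{11}$). - $G_2:\overline{\operatorname{Ran}}\,(I-T_{12}^*T_{12})^{1/2}=(\operatorname{Ker}T_{22})^\perp\to\mathcal U$ is the unique partial isometry with $G_2(I-T_{12}^*T_{12})^{1/2}=T_{22}$ (and $\operatorname{Ker}G_2^*=\operatorname{Ker}T_{22}^*$). - $\mathcal U_S^0=\{u\in\mathcal U:\ S(\lambda)u=0\text{ for all }\lambda\in\mathbb B^d\}=\operatorname{Ker}T_{22}^*$. *)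

(* Defs.v *)
From HB Require Import structures.
From mathcomp Require Import all_boot all_order all_algebra.
From mathcomp Require Import all_classical all_reals all_analysis.
From mathcomp Require Import complex ring.

Set Implicit Arguments.
Unset Strict Implicit.
Unset Printing Implicit Defensive.

Import Order.TTheory GRing.Theory Num.Theory Num.Def.
Import numFieldNormedType.Exports.
Local Open Scope classical_set_scope.
Local Open Scope ring_scope.

HB.mixin Record isHilbert (R : realType) V & CompleteNormedModule R[i] V := {
  inner : V -> V -> R[i];
  inner_linear : forall (a : R[i]) (x y z : V),
    inner (a *: x + y) z = a * inner x z + inner y z;
  inner_conj : forall x y : V, inner y x = (inner x y)^*;
  inner_norm : forall x : V, inner x x = `|x| ^+ 2
}.

#[short(type="hilbertType")]
HB.structure Definition Hilbert (R : realType) :=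
  {V of isHilbert R V & CompleteNormedModule R[i] V}.

Lemma complex_archi (R : realType) (e : R[i]) :
  0 < e -> exists n, n.+1%:R^-1 < e.
Proof.
case: e => a b; rewrite ltcE /= => /andP[/eqP b0 a0].
have a1 : 0 < a^-1 by rewrite invr_gt0.
exists (archi_bound a^-1).
have := archi_boundP (ltW a1); set n := archi_bound _ => na.
have -> : (n.+1%:R : R[i])^-1 = (n.+1%:R^-1)%:C%C by rewrite fmorphV rmorph_nat.
rewrite ltcE /= b0 eqxx /= invf_plt ?posrE// (lt_trans na)// ltr_nat.
exact: ltnSn.
Qed.

Section preHilbert.
Variables (R : realType) (V : lmodType R[i]) (ip : V -> V -> R[i]).
Hypothesis ip_linear : forall (a : R[i]) (x y z : V),
  ip (a *: x + y) z = a * ip x z + ip y z.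
Hypothesis ip_conj : forall x y, ip y x = (ip x y)^*.
Hypothesis ip_ge0 : forall x, 0 <= ip x x.
Hypothesis ip_eq0 : forall x, ip x x = 0 -> x = 0.

Lemma ip0l y : ip 0 y = 0.
Proof.
have := ip_linear 1 0 0 y; rewrite scaler0 addr0 mul1r => /eqP.
by rewrite -subr_eq0 opprD addrA subrr sub0r oppr_eq0 => /eqP.
Qed.

Lemma ipZl a x y : ip (a *: x) y = a * ip x y.
Proof. by rewrite -[a *: x]addr0 ip_linear ip0l addr0. Qed.

Lemma ipDl x y z : ip (x + y) z = ip x z + ip y z.
Proof. by rewrite -[x in LHS]scale1r ip_linear mul1r. Qed.

Lemma ipNl x z : ip (- x) z = - ip x z.
Proof. by rewrite -scaleN1r ipZl mulN1r. Qed.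

Lemma ipDr x y z : ip z (x + y) = ip z x + ip z y.
Proof. by rewrite ip_conj ipDl rmorphD /= -!ip_conj. Qed.

Lemma ipZr a x y : ip x (a *: y) = a^* * ip x y.
Proof. by rewrite ip_conj ipZl rmorphM /= -!ip_conj. Qed.

Lemma ipNr x z : ip z (- x) = - ip z x.
Proof. by rewrite -scaleN1r ipZr rmorphN1 mulN1r. Qed.

Lemma ip_real x : (ip x x)^* = ip x x.
Proof. by rewrite -ip_conj. Qed.

Lemma ip_CauchySchwarz x y : `|ip x y| ^+ 2 <= ip x x * ip y y.
Proof.
have [->|y0] := eqVneq y 0.
  by rewrite (ip_conj 0) !ip0l rmorph0 normr0 expr0n mulr0.
have yy : 0 < ip y y.
  by rewrite lt_def ip_ge0 andbT; apply: contra_neq y0 => /ip_eq0.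
have := ip_ge0 (ip y y *: x - ip x y *: y).
rewrite !(ipDl, ipNl, ipZl, ipDr, ipNr, ipZr) ip_real (ip_conj x y) normCK.
set a := ip x x; set b := ip y y; set c := ip x y.
have -> : b * (b * a - c^* * c) - c * (b * c^* - c^* * b)
  = b * (a * b - c * c^*) by ring.
by rewrite pmulr_rge0// subr_ge0.
Qed.

Lemma ip_triangle x y :
  sqrtC (ip (x + y) (x + y)) <= sqrtC (ip x x) + sqrtC (ip y y).
Proof.
rewrite -(ler_pXn2r (n := 2)) ?nnegrE ?addr_ge0 ?sqrtC_ge0//.
rewrite sqrtCK sqrrD !sqrtCK ipDl !ipDr (ip_conj x y).
set a := ip x x; set b := ip y y; set c := ip x y.
have cab : `|c| <= sqrtC a * sqrtC b.
  rewrite -(ler_pXn2r (n := 2)) ?nnegrE ?mulr_ge0 ?sqrtC_ge0 ?ip_ge0//.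
  by rewrite exprMn !sqrtCK ip_CauchySchwarz.
have -> : a + c + (c^* + b) = a + (c + c^*) + b by rewrite !addrA.
rewrite lerD2r lerD2l mulr2n (le_trans _ (lerD cab cab))//.
have /lerD /(_ (Num.Theory.leif_Re_Creal c).1) := (Num.Theory.leif_Re_Creal c).1.
apply: le_trans.
by rewrite !ReE -splitr.
Qed.

End preHilbert.

HB.factory Record Lmodule_isHilbert (R : realType) V & GRing.Lmodule R[i] V := {
  inner : V -> V -> R[i];
  inner_linear : forall (a : R[i]) (x y z : V),
    inner (a *: x + y) z = a * inner x z + inner y z;
  inner_conj : forall x y : V, inner y x = (inner x y)^*;
  inner_ge0 : forall x : V, 0 <= inner x x;
  inner_eq0 : forall x : V, inner x x = 0 -> x = 0;
  inner_complete : forall u : nat -> V,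
    (forall e : R[i], 0 < e -> exists N, forall m n, (N <= m)%N -> (N <= n)%N ->
       inner (u m - u n) (u m - u n) < e ^+ 2) ->
    exists l, forall e : R[i], 0 < e -> exists N, forall n, (N <= n)%N ->
       inner (u n - l) (u n - l) < e ^+ 2
}.

HB.builders Context R V & Lmodule_isHilbert R V.

Let norm (x : V) := sqrtC (inner x x).

Let hnormD x y : norm (x + y) <= norm x + norm y.
Proof. exact: (ip_triangle inner_linear inner_conj inner_ge0 inner_eq0). Qed.

Let hnormZ (a : R[i]) x : norm (a *: x) = `|a| * norm x.
Proof.
rewrite /norm (ipZl inner_linear) (ipZr inner_linear inner_conj) mulrA.
rewrite -normCK sqrtCM ?nnegrE ?exprn_ge0// ?inner_ge0//.
by rewrite sqrCK.
Qed.

Let hnorm0_eq0 x : norm x = 0 -> x = 0.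
Proof. by move=> /eqP; rewrite sqrtC_eq0 => /eqP /inner_eq0. Qed.

HB.instance Definition _ :=
  Lmodule_isNormed.Build R[i] V hnormD hnormZ hnorm0_eq0.

Let inner_lt (x : V) (e : R[i]) :
  0 < e -> (inner x x < e ^+ 2) = (`|x| < e).
Proof.
move=> e0; rewrite -[inner x x]sqrtCK ltr_pXn2r ?nnegrE ?sqrtC_ge0 ?inner_ge0//.
exact: ltW.
Qed.

Let complete (F : set_system V) : ProperFilter F -> cauchy F -> cvg F.
Proof.
move=> FF /cauchyP Fc.
have en n : 0 < (n.+1%:R : R[i])^-1 by rewrite invr_gt0 ltr0n.
have /choice[u uP] : forall n, exists x, F (ball x (n.+1%:R : R[i])^-1).
  by move=> n; apply: Fc.
have uu N m n : (N <= m)%N -> (N <= n)%N ->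
    `|u m - u n| < (N.+1%:R : R[i])^-1 + N.+1%:R^-1.
  move=> Nm Nn; have [z []] := filter_ex (filterI (uP m) (uP n)).
  rewrite -!ball_normE /= => mz nz.
  rewrite -(subrKA z) (le_lt_trans (ler_normD _ _))// ltrD//.
    by rewrite (lt_le_trans mz)// lef_pV2 ?posrE ?ltr0n// ler_nat.
  by rewrite -normrN opprB (lt_le_trans nz)// lef_pV2 ?posrE ?ltr0n// ler_nat.
have arch2 (e : R[i]) : 0 < e -> exists N, (N.+1%:R : R[i])^-1 + N.+1%:R^-1 < e.
  move=> e0; have [|N Ne] := @complex_archi _ (e / 2); first by rewrite divr_gt0.
  by exists N; rewrite [ltRHS]splitr ltrD.
have [e e0|l lP] := inner_complete (u := u).
  have [N Ne] := arch2 _ e0; exists N => m n Nm Nn.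
  by rewrite inner_lt// (lt_trans (uu _ _ _ Nm Nn)).
apply/cvg_ex; exists l; apply/cvgrPdist_lt => e e0.
have [|N Ne] := @complex_archi _ (e / 2); first by rewrite divr_gt0.
have [|M Ml] := lP (e / 2); first by rewrite divr_gt0.
have := uP (maxn M N); apply: filterS => z; rewrite -ball_normE /= => uz.
rewrite [ltRHS]splitr -(subrKA (u (maxn M N))) (le_lt_trans (ler_normD _ _))// ltrD//.
  by rewrite -normrN opprB -inner_lt ?divr_gt0// Ml ?leq_maxl.
rewrite (lt_trans uz)// (le_lt_trans _ Ne)//.
by rewrite lef_pV2 ?posrE ?ltr0n// ler_nat ltnS leq_maxr.
Qed.

HB.instance Definition _ := Uniform_isComplete.Build V complete.

Let inner_norm (x : V) : inner x x = `|x| ^+ 2.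
Proof. exact: esym (sqrtCK _). Qed.

HB.instance Definition _ :=
  isHilbert.Build R V inner_linear inner_conj inner_norm.

HB.end.

Section inner_theory.
Variables (R : realType) (H : hilbertType R).
Implicit Types (x y z : H) (a : R[i]).

Lemma inner_ge0 x : 0 <= inner x x.
Proof. by rewrite inner_norm exprn_ge0. Qed.

Lemma inner_eq0 x : inner x x = 0 -> x = 0.
Proof. by rewrite inner_norm => /eqP; rewrite sqrf_eq0 normr_eq0 => /eqP. Qed.

Lemma inner_complete (u : nat -> H) :
  (forall e : R[i], 0 < e -> exists N, forall m n, (N <= m)%N -> (N <= n)%N ->
     inner (u m - u n) (u m - u n) < e ^+ 2) ->
  exists l, forall e : R[i], 0 < e -> exists N, forall n, (N <= n)%N ->
     inner (u n - l) (u n - l) < e ^+ 2.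
Proof.
have inE x e : 0 < e -> (inner x x < e ^+ 2) = (`|x| < e).
  by move=> e0; rewrite inner_norm ltr_pXn2r ?nnegrE// ltW.
move=> uc; have : cvg (u @ \oo).
  apply/cauchy_cvgP/cauchyP => e e0; have [N uN] := uc e e0.
  exists (u N); exists N => // n /= Nn.
  by rewrite -ball_normE /= -inE// uN.
move=> /cvg_ex[l /cvgrPdist_lt ul]; exists l => e e0.
have [N _ uN] := ul e e0; exists N => n Nn.
by rewrite inE// -normrN opprB; apply: uN.
Qed.

End inner_theory.

(* Orthogonal direct sum: the library's norm on [H * K] is the sup norm, hence
   the alias. *)
Definition hsum (H K : Type) : Type := (H * K)%type.

Section hsum_instance.
Variables (R : realType) (H K : hilbertType R).

HB.instance Definition _ := GRing.Lmodule.copy (hsum H K) (H * K)%type.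

Definition hsum_inner (p q : hsum H K) : R[i] := inner p.1 q.1 + inner p.2 q.2.

Let hsum_linear a (p q r : hsum H K) :
  hsum_inner (a *: p + q) r = a * hsum_inner p r + hsum_inner q r.
Proof. by rewrite /hsum_inner !inner_linear; ring. Qed.

Let hsum_conj (p q : hsum H K) : hsum_inner q p = (hsum_inner p q)^*.
Proof. by rewrite /hsum_inner rmorphD /= -!inner_conj. Qed.

Let hsum_ge0 (p : hsum H K) : 0 <= hsum_inner p p.
Proof. by rewrite addr_ge0 ?inner_ge0. Qed.

Let hsum_eq0 (p : hsum H K) : hsum_inner p p = 0 -> p = 0.
Proof.
case: p => x y /eqP; rewrite paddr_eq0 ?inner_ge0// => /andP[/eqP + /eqP].
by move=> /= /inner_eq0 -> /inner_eq0 ->.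
Qed.

Let hsum_complete (u : nat -> hsum H K) :
  (forall e : R[i], 0 < e -> exists N, forall m n, (N <= m)%N -> (N <= n)%N ->
     hsum_inner (u m - u n) (u m - u n) < e ^+ 2) ->
  exists l, forall e : R[i], 0 < e -> exists N, forall n, (N <= n)%N ->
     hsum_inner (u n - l) (u n - l) < e ^+ 2.
Proof.
move=> uc.
have [e e0|l1 l1P] := @inner_complete _ H (fun n => (u n).1).
  have [N uN] := uc e e0; exists N => m n Nm Nn.
  by rewrite (le_lt_trans _ (uN m n Nm Nn))// lerDl inner_ge0.
have [e e0|l2 l2P] := @inner_complete _ K (fun n => (u n).2).
  have [N uN] := uc e e0; exists N => m n Nm Nn.
  by rewrite (le_lt_trans _ (uN m n Nm Nn))// lerDr inner_ge0.
exists (l1, l2) => e e0.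
have e2 : 0 < e / 2 by rewrite divr_gt0.
have [[M lM] [N lN]] := (l1P _ e2, l2P _ e2).
exists (maxn M N) => n; rewrite geq_max => /andP[Mn Nn].
rewrite (lt_le_trans (ltrD (lM _ Mn) (lN _ Nn)))//.
rewrite -mulr2n exprMn -mulrnAr ler_piMr ?exprn_ge0 ?(ltW e0)//.
rewrite exprVn -mulr_natr -natrX ler_pdivrMl ?ltr0n// mulr1 ler_nat//.
Qed.

HB.instance Definition _ := Lmodule_isHilbert.Build R (hsum H K)
  hsum_linear hsum_conj hsum_ge0 hsum_eq0 hsum_complete.

End hsum_instance.

(* $H^d$ with the $\ell^2$ inner product *)
Definition hpow (d : nat) (H : Type) : Type := {ffun 'I_d -> H}.

Section hpow_instance.
Variables (R : realType) (d : nat) (H : hilbertType R).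

HB.instance Definition _ := GRing.Lmodule.copy (hpow d H) {ffun 'I_d -> H}.

Definition hpow_inner (p q : hpow d H) : R[i] := \sum_j inner (p j) (q j).

Let hpow_linear a (p q r : hpow d H) :
  hpow_inner (a *: p + q) r = a * hpow_inner p r + hpow_inner q r.
Proof.
rewrite /hpow_inner mulr_sumr -big_split; apply: eq_bigr => j _ /=.
by rewrite !ffunE inner_linear.
Qed.

Let hpow_conj (p q : hpow d H) : hpow_inner q p = (hpow_inner p q)^*.
Proof.
by rewrite /hpow_inner rmorph_sum; apply: eq_bigr => j _; exact: inner_conj.
Qed.

Let hpow_ge0 (p : hpow d H) : 0 <= hpow_inner p p.
Proof. by apply: sumr_ge0 => j _; exact: inner_ge0. Qed.

Let hpow_eq0 (p : hpow d H) : hpow_inner p p = 0 -> p = 0.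
Proof.
move=> /eqP; rewrite psumr_eq0; last by move=> j _; exact: inner_ge0.
move=> /allP p0; apply/ffunP => j; rewrite ffunE; apply: inner_eq0.
by apply/eqP; apply: p0; rewrite mem_index_enum.
Qed.

Let hpow_complete (u : nat -> hpow d H) :
  (forall e : R[i], 0 < e -> exists N, forall m n, (N <= m)%N -> (N <= n)%N ->
     hpow_inner (u m - u n) (u m - u n) < e ^+ 2) ->
  exists l, forall e : R[i], 0 < e -> exists N, forall n, (N <= n)%N ->
     hpow_inner (u n - l) (u n - l) < e ^+ 2.
Proof.
move=> uc.
have /choice[l lP] : forall j, exists l, forall e : R[i], 0 < e ->
    exists N, forall n, (N <= n)%N -> inner (u n j - l) (u n j - l) < e ^+ 2.
  move=> j; apply: inner_complete => e e0.
  have [N uN] := uc e e0; exists N => m n Nm Nn.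
  rewrite (le_lt_trans _ (uN m n Nm Nn))// /hpow_inner (bigD1 j)//= !ffunE lerDl.
  by apply: sumr_ge0 => k _; exact: inner_ge0.
exists [ffun j => l j] => e e0.
have e2 : 0 < e / d.+1%:R by rewrite divr_gt0.
have /choice[N NP] : forall j, exists N, forall n, (N <= n)%N ->
   inner (u n j - l j) (u n j - l j) < (e / d.+1%:R) ^+ 2.
  by move=> j; apply: lP.
exists (\max_j N j)%N => n Nn.
rewrite (@le_lt_trans _ _ (\sum_(j < d) (e / d.+1%:R) ^+ 2))//.
  apply: ler_sum => j _; rewrite !ffunE ltW// NP// (leq_trans _ Nn)//.
  exact: leq_bigmax.
rewrite sumr_const card_ord exprMn -mulrnAr -[ltRHS]mulr1 ltr_pM2l ?exprn_gt0//.
rewrite exprVn -mulr_natr -natrX ltr_pdivrMl ?ltr0n ?expn_gt0// mulr1 ltr_nat//.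
by rewrite (@leq_trans d.+1)// leq_pmulr.
Qed.

HB.instance Definition _ := Lmodule_isHilbert.Build R (hpow d H)
  hpow_linear hpow_conj hpow_ge0 hpow_eq0 hpow_complete.

End hpow_instance.

Section approximation.
Variables (R : realType) (H : hilbertType R).
Implicit Types (S : set H) (x : H).

Lemma closureP_lt S x :
  closure S x <-> forall e : R[i], 0 < e -> exists2 s, S s & `|x - s| < e.
Proof.
split=> [Sx e e0|Sx B /nbhs_ballP[e /= e0 eB]].
  have [s []] := Sx _ (nbhsx_ballx x e e0).
  by rewrite -ball_normE /= => Ss xs; exists s.
have [s Ss xs] := Sx e e0; exists s; split => //; apply: eB.
by rewrite -ball_normE.
Qed.

Lemma closed_approx S :
  (forall x, (forall e : R[i], 0 < e -> exists2 s, S s & `|x - s| < e) -> S x) ->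
  closed S.
Proof. by move=> SS x /closureP_lt /SS. Qed.

Lemma eq0_approx (K : normedModType R[i]) (y : K) (M : R[i]) :
  (forall e : R[i], 0 < e -> `|y| <= M * e) -> y = 0.
Proof.
move=> yM; apply/eqP; rewrite -normr_eq0; apply/eqP.
have M0 : 0 <= M by have := le_trans (normr_ge0 y) (yM 1 ltr01); rewrite mulr1.
apply/eqP; rewrite eq_le normr_ge0 andbT; apply/ler_addgt0Pr => e e0.
rewrite add0r; have M1 : 0 < M + 1 by rewrite ltr_wpDl.
rewrite (le_trans (yM (e / (M + 1)) _)) ?divr_gt0//.
by rewrite mulrA ler_pdivrMr// mulrC ler_pM2l// lerDl.
Qed.

Lemma inner_CauchySchwarz (x y : H) : `|inner x y| <= `|x| * `|y|.
Proof.
rewrite -(ler_pXn2r (n := 2)) ?nnegrE ?mulr_ge0// exprMn -!inner_norm.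
exact: (ip_CauchySchwarz inner_linear inner_conj (@inner_ge0 _ _) (@inner_eq0 _ _)).
Qed.

End approximation.

Definition is_subspace (R : realType) (H : hilbertType R) (S : set H) : Prop :=
  S 0 /\ forall (a : R[i]) x y, S x -> S y -> S (a *: x + y).

Record csubspace (R : realType) (H : hilbertType R) := CSubspace {
  cs_set : set H;
  cs_subspace : is_subspace cs_set;
  cs_closed : closed cs_set
}.

Definition cs_pred (R : realType) (H : hilbertType R) (D : csubspace H) :
  {pred H} := [pred x | x \in cs_set D].

Record cs_type (R : realType) (H : hilbertType R) (D : csubspace H) := CsElt {
  cs_val : H;
  cs_valP : cs_val \in cs_pred D
}.

Section csubspace_instance.
Variables (R : realType) (H : hilbertType R) (D : csubspace H).

HB.instance Definition _ := [isSub for @cs_val R H D].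
HB.instance Definition _ := [Choice of cs_type D by <:].

Let cs_submod_closed : submod_closed (cs_pred D).
Proof.
have [D0 DD] := cs_subspace D; split; first exact/mem_set.
by move=> a x y /set_mem xD /set_mem yD; apply/mem_set/DD.
Qed.

HB.instance Definition _ :=
  GRing.isSubmodClosed.Build _ _ (cs_pred D) cs_submod_closed.
HB.instance Definition _ := [SubChoice_isSubLmodule of cs_type D by <:].

Definition cs_inner (x y : cs_type D) : R[i] := inner (val x) (val y).

Let cs_inner_linear a (x y z : cs_type D) :
  cs_inner (a *: x + y) z = a * cs_inner x z + cs_inner y z.
Proof. exact: inner_linear. Qed.

Let cs_inner_conj (x y : cs_type D) : cs_inner y x = (cs_inner x y)^*.
Proof. exact: inner_conj. Qed.

Let cs_inner_ge0 (x : cs_type D) : 0 <= cs_inner x x.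
Proof. exact: inner_ge0. Qed.

Let cs_inner_eq0 (x : cs_type D) : cs_inner x x = 0 -> x = 0.
Proof. by move=> /inner_eq0 x0; apply: val_inj. Qed.

Let cs_complete (u : nat -> cs_type D) :
  (forall e : R[i], 0 < e -> exists N, forall m n, (N <= m)%N -> (N <= n)%N ->
     cs_inner (u m - u n) (u m - u n) < e ^+ 2) ->
  exists l, forall e : R[i], 0 < e -> exists N, forall n, (N <= n)%N ->
     cs_inner (u n - l) (u n - l) < e ^+ 2.
Proof.
move=> uc; have [l lP] := @inner_complete _ H (val \o u) uc.
suff Dl : l \in cs_pred D by exists (CsElt Dl).
apply/mem_set/(cs_closed (c := D))/closureP_lt => e e0.
have [N /(_ N (leqnn _))] := lP e e0.
exists (val (u N)); first exact/set_mem/cs_valP.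
rewrite -(ltr_pXn2r (n := 2)) ?nnegrE ?(ltW e0)// -inner_norm.
by rewrite -opprB (ipNl inner_linear) (ipNr inner_linear inner_conj) opprK.
Qed.

HB.instance Definition _ := Lmodule_isHilbert.Build R (cs_type D)
  cs_inner_linear cs_inner_conj cs_inner_ge0 cs_inner_eq0 cs_complete.

End csubspace_instance.

Coercion cs_hilbert (R : realType) (H : hilbertType R) (D : csubspace H) :
  hilbertType R := cs_type D.

Section csubspaces.
Variables (R : realType) (H : hilbertType R).

Lemma closure_subspace (S : set H) : is_subspace S -> is_subspace (closure S).
Proof.
move=> [S0 SS]; split; first exact: subset_closure.
move=> a x y /closureP_lt Sx /closureP_lt Sy; apply/closureP_lt => e e0.
have a1 : 0 < `|a| + 1 by rewrite ltr_wpDl.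
have [|s Ss xs] := Sx (e / 2 / (`|a| + 1)); first by rewrite !divr_gt0.
have [|t St yt] := Sy (e / 2); first by rewrite divr_gt0.
exists (a *: s + t); first exact: SS.
rewrite opprD addrACA -scalerBr (le_lt_trans (ler_normD _ _))// normrZ.
rewrite [ltRHS]splitr ler_ltD// (le_trans (ler_wpM2l _ (ltW xs)))//.
by rewrite mulrCA ger_pMr ?divr_gt0// ler_pdivrMr// mul1r lerDl.
Qed.

Lemma smallest_subspace (G : set H) : is_subspace (smallest (@is_subspace R H) G).
Proof.
split=> [A [[]]//|a x y Sx Sy A [As GA]].
by apply: As.2; [exact: Sx|exact: Sy].
Qed.

Definition closure_cs (S : set H) (SS : is_subspace S) : csubspace H :=
  CSubspace (closure_subspace SS) (@closed_closure _ S).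

Definition cspan (G : set H) : csubspace H := closure_cs (smallest_subspace G).

Lemma orth_subspace (G : set H) :
  is_subspace [set x | forall y, G y -> inner x y = 0].
Proof.
split=> [y _|a x y Gx Gy z Gz]; first exact: (ip0l inner_linear).
by rewrite inner_linear Gx// Gy// mulr0 addr0.
Qed.

Lemma orth_closed (G : set H) :
  closed [set x : H | forall y, G y -> inner x y = 0].
Proof.
apply: closed_approx => x xG y Gy; apply: (@eq0_approx _ (R[i])^o _ `|y|).
move=> e e0; have [s /(_ _ Gy) sy xs] := xG e e0.
have -> : inner x y = inner (x - s) y.
  by rewrite (ipDl inner_linear) (ipNl inner_linear) sy subr0.
by rewrite (le_trans (inner_CauchySchwarz _ _))// mulrC ler_wpM2l// ltW.
Qed.

Definition orth (G : set H) : csubspace H :=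
  CSubspace (orth_subspace G) (@orth_closed G).

Lemma setI_subspace (D E : csubspace H) : is_subspace (cs_set D `&` cs_set E).
Proof.
have [D0 DD] := cs_subspace D; have [E0 EE] := cs_subspace E; split=> //.
by move=> a x y [Dx Ex] [Dy Ey]; split; [exact: DD|exact: EE].
Qed.

Definition cs_cap (D E : csubspace H) : csubspace H :=
  CSubspace (setI_subspace D E) (closedI (cs_closed (c:=D)) (cs_closed (c:=E))).

End csubspaces.

Section bounded_operators.
Variables (R : realType) (H K : hilbertType R).

Definition bounded_linear : {pred H -> K} :=
  [pred f | `[< linear f /\ exists M : R[i], forall x, `|f x| <= M * `|x| >]].

Record bop := BOp { bop_fun :> H -> K; bopP : bop_fun \in bounded_linear }.

HB.instance Definition _ := [isSub for bop_fun].
HB.instance Definition _ := [Choice of bop by <:].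

Let bounded_linear_submod_closed : submod_closed bounded_linear.
Proof.
split=> [|a f g /asboolP[lf [M fM]] /asboolP[lg [N gN]]]; apply/asboolP; split.
- by move=> a x y /=; rewrite scaler0 addr0.
- by exists 0 => x /=; rewrite normr0 mul0r.
- move=> b x y; rewrite -[LHS]/(a *: f (b *: x + y) + g (b *: x + y)).
  rewrite -[RHS]/(b *: (a *: f x + g x) + (a *: f y + g y)).
  by rewrite lf lg !scalerDr !scalerA addrACA [a * b]mulrC.
- exists (`|a| * M + N) => x; rewrite -[_ x]/(a *: f x + g x).
  rewrite (le_trans (ler_normD _ _))// mulrDl lerD// normrZ -mulrA.
  by rewrite ler_wpM2l.
Qed.

HB.instance Definition _ :=
  GRing.isSubmodClosed.Build _ _ bounded_linear bounded_linear_submod_closed.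
HB.instance Definition _ := [SubChoice_isSubLmodule of bop by <:].

Lemma bop_linear (T : bop) : linear T.
Proof. by have /asboolP[] := bopP T. Qed.

Lemma bop_bounded (T : bop) : exists M : R[i], forall x, `|T x| <= M * `|x|.
Proof. by have /asboolP[] := bopP T. Qed.

Lemma mk_bop_subproof (f : H -> K) (lf : linear f)
  (bf : exists M : R[i], forall x, `|f x| <= M * `|x|) : f \in bounded_linear.
Proof. exact/asboolP. Qed.

Definition mk_bop f lf bf : bop := BOp (@mk_bop_subproof f lf bf).

Lemma bopP_eq (S T : bop) : (forall x, S x = T x) -> S = T.
Proof. by move=> ST; apply/val_inj/funext. Qed.

Lemma bop0 (T : bop) : T 0 = 0.
Proof.
by have := bop_linear T (-1) 0 0; rewrite scaleN1r oppr0 addr0 scaleN1r addNr.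
Qed.

Lemma bopZ (T : bop) a x : T (a *: x) = a *: T x.
Proof. by have := bop_linear T a x 0; rewrite !addr0 bop0 addr0. Qed.

Definition opnorm (T : bop) : R[i] :=
  (sup [set complex.Re `|T x| | x in [set x : H | `|x| <= 1]])%:C%C.

Let Re_normK (V : normedModType R[i]) (v : V) : (complex.Re `|v|)%:C%C = `|v|.
Proof. by rewrite RRe_real// normr_real. Qed.

Let opset_has_sup (T : bop) :
  has_sup [set complex.Re `|T x| | x in [set x : H | `|x| <= 1]].
Proof.
have [M TM] := bop_bounded T; split; first by exists (complex.Re `|T 0|), 0; rewrite //= normr0.
exists (complex.Re `|M|) => _ [x /= x1 <-]; rewrite -lecR Re_normK.
have -> : (complex.Re `|M|)%:C%C = `|M| by rewrite RRe_real// normr_real.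
have Mx : 0 <= M * `|x| by rewrite (le_trans _ (TM x)).
rewrite (le_trans (TM x))// -(ger0_norm Mx) normrM normr_id.
by rewrite ler_piMr.
Qed.

Lemma le_opnorm (T : bop) x : `|T x| <= opnorm T * `|x|.
Proof.
have [->|x0] := eqVneq x 0; first by rewrite bop0 !normr0 mulr0.
have x1 : 0 < `|x| by rewrite normr_gt0.
rewrite -ler_pdivrMr// -[_^-1]ger0_norm ?invr_ge0// mulrC -normrZ -bopZ.
rewrite -Re_normK lecR; apply: ub_le_sup; first exact: (opset_has_sup T).2.
exists (`|x|^-1 *: x) => //=.
by rewrite normrZ ger0_norm ?invr_ge0// mulVf// gt_eqF.
Qed.

Lemma opnorm_le (T : bop) (M : R[i]) :
  0 <= M -> (forall x, `|T x| <= M * `|x|) -> opnorm T <= M.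
Proof.
move=> M0 TM; have MR : (complex.Re M)%:C%C = M by rewrite RRe_real// ger0_real.
rewrite -MR lecR; apply: ge_sup; first exact: (opset_has_sup T).1.
move=> _ [x /= x1 <-]; rewrite -lecR MR Re_normK.
by rewrite (le_trans (TM x))// ler_piMr.
Qed.

Let opnorm_ge0 (T : bop) : 0 <= opnorm T.
Proof.
rewrite ler0c; apply: (@le_trans _ _ (complex.Re `|T 0|)).
  by rewrite -ler0c Re_normK.
apply: ub_le_sup; first exact: (opset_has_sup T).2.
by exists 0; rewrite //= normr0.
Qed.

Let opnormD (S T : bop) : opnorm (S + T) <= opnorm S + opnorm T.
Proof.
apply: opnorm_le => [|x]; first by rewrite addr_ge0.
rewrite mulrDl; apply: le_trans (lerD (le_opnorm S x) (le_opnorm T x)).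
exact: ler_normD.
Qed.

Let opnormZ_le a (T : bop) : opnorm (a *: T) <= `|a| * opnorm T.
Proof.
apply: opnorm_le => [|x]; first by rewrite mulr_ge0.
by rewrite [`|_|]normrZ -mulrA ler_wpM2l// le_opnorm.
Qed.

Let opnormZ a (T : bop) : opnorm (a *: T) = `|a| * opnorm T.
Proof.
have [->|a0] := eqVneq a 0.
  rewrite normr0 mul0r; apply/eqP; rewrite eq_le opnorm_ge0 andbT.
  by rewrite (le_trans (opnormZ_le _ _))// normr0 mul0r.
apply/eqP; rewrite eq_le opnormZ_le /=.
have := opnormZ_le a^-1 (a *: T).
by rewrite scalerA mulVf// scale1r normfV ler_pdivlMl// normr_gt0.
Qed.

Let opnorm0_eq0 (T : bop) : opnorm T = 0 -> T = 0.
Proof.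
move=> T0; apply: bopP_eq => x; apply/eqP; rewrite -normr_eq0 eq_le normr_ge0.
by rewrite (le_trans (le_opnorm T x))// T0 mul0r.
Qed.

HB.instance Definition _ :=
  Lmodule_isNormed.Build R[i] bop opnormD opnormZ opnorm0_eq0.

Lemma bop_norm (T : bop) x : `|T x| <= `|T| * `|x|.
Proof. exact: le_opnorm. Qed.

End bounded_operators.

Notation "''L(' H , K )" := (bop H K) (format "''L(' H ,  K )") : type_scope.

Section hsum_norms.
Variable R : realType.

Lemma hilbert_norm_le (H K : hilbertType R) (x : H) (y : K) :
  inner x x <= inner y y -> `|x| <= `|y|.
Proof. by rewrite !inner_norm ler_pXn2r ?nnegrE. Qed.

Lemma hsum_norm_fst (H K : hilbertType R) (p : hsum H K) : `|p.1| <= `|p|.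
Proof. by apply: hilbert_norm_le; rewrite lerDl inner_ge0. Qed.

Lemma hsum_norm_snd (H K : hilbertType R) (p : hsum H K) : `|p.2| <= `|p|.
Proof. by apply: hilbert_norm_le; rewrite lerDr inner_ge0. Qed.

Lemma hsum_norm_le (H K : hilbertType R) (p : hsum H K) : `|p| <= `|p.1| + `|p.2|.
Proof.
rewrite -(ler_pXn2r (n := 2)) ?nnegrE ?addr_ge0// -inner_norm.
rewrite -[inner p p]/(inner p.1 p.1 + inner p.2 p.2) !inner_norm sqrrD.
by rewrite lerD2r lerDl mulrn_wge0// mulr_ge0.
Qed.

Lemma hpow_norm_coord d (H : hilbertType R) (p : hpow d H) j : `|p j| <= `|p|.
Proof.
apply: hilbert_norm_le; rewrite -[leRHS]/(\sum_k inner (p k) (p k)) (bigD1 j)//=.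
by rewrite lerDl sumr_ge0// => k _; exact: inner_ge0.
Qed.

Lemma hpow_norm_le d (H : hilbertType R) (p : hpow d H) : `|p| <= \sum_j `|p j|.
Proof.
rewrite -(ler_pXn2r (n := 2)) ?nnegrE ?sumr_ge0// -inner_norm.
rewrite -[inner p p]/(\sum_k inner (p k) (p k)) expr2 mulr_suml.
apply: ler_sum => j _; rewrite inner_norm expr2 ler_wpM2l//.
by rewrite (bigD1 j)//= lerDl sumr_ge0.
Qed.

End hsum_norms.

Section operators.
Variable R : realType.
Implicit Types H K L : hilbertType R.

Lemma id_bounded H : exists M : R[i], forall x : H, `|idfun x| <= M * `|x|.
Proof. by exists 1 => x; rewrite mul1r. Qed.

Definition bop_id H : 'L(H, H) := mk_bop (fun a x y => erefl) (id_bounded H).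

Lemma comp_linear H K L (S : 'L(K, L)) (T : 'L(H, K)) : linear (S \o T).
Proof. by move=> a x y /=; rewrite !bop_linear. Qed.

Lemma comp_bounded H K L (S : 'L(K, L)) (T : 'L(H, K)) :
  exists M : R[i], forall x, `|(S \o T) x| <= M * `|x|.
Proof.
exists (`|S| * `|T|) => x; rewrite (le_trans (bop_norm S _))//.
by rewrite -mulrA ler_wpM2l// bop_norm.
Qed.

Definition bop_comp H K L (S : 'L(K, L)) (T : 'L(H, K)) : 'L(H, L) :=
  mk_bop (comp_linear S T) (comp_bounded S T).

(* The adjoint, the inverse and the positive square root are picked among the
   operators with the defining property; each of them is unique when it exists. *)
Definition adjoint H K (T : 'L(H, K)) : 'L(K, H) :=
  xget 0 [set T' : 'L(K, H) | forall x y, inner (T x) y = inner x (T' y)].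

Definition bop_inv H K (T : 'L(H, K)) : 'L(K, H) :=
  xget 0 [set T' : 'L(K, H) | bop_comp T' T = bop_id H /\ bop_comp T T' = bop_id K].

Definition positive_op H (T : 'L(H, H)) : Prop := forall x, 0 <= inner (T x) x.

Definition le_op H (S T : 'L(H, H)) : Prop := positive_op (T - S).

Definition bop_sqrt H (T : 'L(H, H)) : 'L(H, H) :=
  xget 0 [set N : 'L(H, H) | positive_op N /\ bop_comp N N = T].

Definition contractive H K (T : 'L(H, K)) : Prop := forall x, `|T x| <= `|x|.
Definition isometric H K (T : 'L(H, K)) : Prop := forall x, `|T x| = `|x|.
Definition coisometric H K (T : 'L(H, K)) : Prop := isometric (adjoint T).
Definition unitary H K (T : 'L(H, K)) : Prop := isometric T /\ coisometric T.

Lemma ker_subspace H K (T : 'L(H, K)) : is_subspace [set x : H | T x = 0].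
Proof.
split=> [|a x y /= Tx Ty]; first exact: bop0.
by rewrite /= bop_linear Tx Ty scaler0 addr0.
Qed.

Lemma ker_closed H K (T : 'L(H, K)) : closed [set x : H | T x = 0].
Proof.
apply: closed_approx => x xT; apply: (@eq0_approx _ _ _ `|T|) => e e0.
have [s Ts xs] := xT e e0.
have -> : T x = T (x - s).
  by rewrite addrC -scaleN1r bop_linear Ts scaler0 add0r.
by rewrite (le_trans (bop_norm T _))// ler_wpM2l// ltW.
Qed.

Definition bop_ker H K (T : 'L(H, K)) : csubspace H :=
  CSubspace (ker_subspace T) (@ker_closed _ _ T).

Definition partial_isometry H K (T : 'L(H, K)) : Prop :=
  forall x, cs_set (orth (cs_set (bop_ker T))) x -> `|T x| = `|x|.

Lemma range_subspace H K (T : 'L(H, K)) : is_subspace (range T).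
Proof.
split=> [|a _ _ [x _ <-] [y _ <-]]; first by exists 0; rewrite ?bop0.
by exists (a *: x + y) => //; rewrite bop_linear.
Qed.

Definition cran H K (T : 'L(H, K)) : csubspace K := closure_cs (range_subspace T).

Lemma incl_linear H (D : csubspace H) : linear (val : D -> H).
Proof. by []. Qed.

Lemma incl_bounded H (D : csubspace H) :
  exists M : R[i], forall x : D, `|val x| <= M * `|x|.
Proof. by exists 1 => x; rewrite mul1r hilbert_norm_le. Qed.

Definition cs_incl H (D : csubspace H) : 'L(D, H) :=
  mk_bop (@incl_linear H D) (incl_bounded D).

Definition bop_proj H (D : csubspace H) : 'L(H, D) := adjoint (cs_incl D).

Lemma mem_cran H K (T : 'L(H, K)) x : T x \in cs_pred (cran T).
Proof. by apply/mem_set/subset_closure; exists x. Qed.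

Lemma corestr_linear H K (T : 'L(H, K)) :
  linear (fun x => CsElt (mem_cran T x) : cran T).
Proof. by move=> a x y; apply: val_inj; rewrite /= bop_linear. Qed.

Lemma corestr_bounded H K (T : 'L(H, K)) :
  exists M : R[i], forall x, `|CsElt (mem_cran T x) : cran T| <= M * `|x|.
Proof.
exists `|T| => x; apply: le_trans (bop_norm T x).
exact: hilbert_norm_le.
Qed.

(* [T] as an operator into the closure of its range *)
Definition corestr H K (T : 'L(H, K)) : 'L(H, cran T) :=
  mk_bop (corestr_linear T) (corestr_bounded T).

Lemma row_linear H K L (S : 'L(H, L)) (T : 'L(K, L)) :
  linear (fun p : hsum H K => S p.1 + T p.2).
Proof.
by move=> a p q /=; rewrite !bop_linear scalerDr addrACA.
Qed.

Lemma row_bounded H K L (S : 'L(H, L)) (T : 'L(K, L)) :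
  exists M : R[i], forall p : hsum H K, `|S p.1 + T p.2| <= M * `|p|.
Proof.
exists (`|S| + `|T|) => p; rewrite (le_trans (ler_normD _ _))// mulrDl.
rewrite lerD// (le_trans (bop_norm _ _))// ler_wpM2l//.
  exact: hsum_norm_fst.
exact: hsum_norm_snd.
Qed.

Definition row_op H K L (S : 'L(H, L)) (T : 'L(K, L)) : 'L(hsum H K, L) :=
  mk_bop (row_linear S T) (row_bounded S T).

Lemma pair_linear H K L (S : 'L(H, K)) (T : 'L(H, L)) :
  linear (fun x => (S x, T x) : hsum K L).
Proof. by move=> a x y; rewrite !bop_linear. Qed.

Lemma pair_bounded H K L (S : 'L(H, K)) (T : 'L(H, L)) :
  exists M : R[i], forall x, `|(S x, T x) : hsum K L| <= M * `|x|.
Proof.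
exists (`|S| + `|T|) => x; rewrite (le_trans (hsum_norm_le _))// mulrDl.
by rewrite lerD// bop_norm.
Qed.

Definition pair_op H K L (S : 'L(H, K)) (T : 'L(H, L)) : 'L(H, hsum K L) :=
  mk_bop (pair_linear S T) (pair_bounded S T).

Definition block_op H1 H2 K1 K2 (A : 'L(H1, K1)) (B : 'L(H2, K1))
    (C : 'L(H1, K2)) (D : 'L(H2, K2)) : 'L(hsum H1 H2, hsum K1 K2) :=
  pair_op (row_op A B) (row_op C D).

Lemma col_linear d H K (T : 'I_d -> 'L(H, K)) :
  linear (fun x => [ffun j => T j x] : hpow d K).
Proof. by move=> a x y; apply/ffunP => j; rewrite !ffunE bop_linear. Qed.

Lemma col_bounded d H K (T : 'I_d -> 'L(H, K)) :
  exists M : R[i], forall x, `|[ffun j => T j x] : hpow d K| <= M * `|x|.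
Proof.
exists (\sum_j `|T j|) => x; rewrite (le_trans (hpow_norm_le _))// mulr_suml.
by apply: ler_sum => j _; rewrite ffunE bop_norm.
Qed.

Definition col_op d H K (T : 'I_d -> 'L(H, K)) : 'L(H, hpow d K) :=
  mk_bop (col_linear T) (col_bounded T).

End operators.

Arguments bop_id {R H}.
Notation "S \oc T" := (bop_comp S T)
  (at level 40, left associativity, format "S  \oc  T") : ring_scope.
Notation "T ^H" := (adjoint T) (at level 2, format "T ^H") : ring_scope.

(* The dimension is the cardinality of an orthonormal basis; a Hilbert
   space has one, and all of them are equinumerous, so that dimensions may be
   compared on one choice of bases. *)
Definition orthonormal_basis (R : realType) (H : hilbertType R) (e : set H) : Prop :=
  [/\ forall x, e x -> `|x| = 1,
      forall x y, e x -> e y -> x <> y -> inner x y = 0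
    & cs_set (cspan e) = setT].

Definition dim_le (R : realType) (H K : hilbertType R) : Prop :=
  exists (e : set H) (f : set K),
    [/\ orthonormal_basis e, orthonormal_basis f & (e #<= f)%card].

Definition dim_eq (R : realType) (H K : hilbertType R) : Prop :=
  exists (e : set H) (f : set K),
    [/\ orthonormal_basis e, orthonormal_basis f & (e #= f)%card].

Section drury_arveson.
Variables (R : realType) (d : nat).
Implicit Types l z : 'rV[R[i]]_d.

Definition cdot l z : R[i] := \sum_j l 0 j * (z 0 j)^*.

Definition unit_ball : set 'rV[R[i]]_d := [set l | cdot l l < 1].

Definition da_kernel l z : R[i] := (1 - cdot l z)^-1.

(* [ev] presents the Hilbert space [H] as a space of functions on the set [Om]:
   it is linear, and injective once its values are restricted to [Om]. *)
Definition function_space (T : Type) (Om : set T) (V : lmodType R[i])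
    (H : hilbertType R) (ev : H -> T -> V) : Prop :=
  (forall a f g t, Om t -> ev (a *: f + g) t = a *: ev f t + ev g t) /\
  (forall f, (forall t, Om t -> ev f t = 0) -> f = 0).

Definition is_rkhs (T : Type) (Om : set T) (k : T -> T -> R[i])
    (H : hilbertType R) (ev : H -> T -> R[i]^o) : Prop :=
  function_space Om ev /\
  forall t, Om t -> exists kt : H,
    (forall s, Om s -> ev kt s = k s t) /\ (forall f, ev f t = inner f kt).

(* [H] is the Hilbert space tensor product of the function space [H0] and [Y],
   [tens f y] being the elementary tensor of [f] and [y], viewed as the space of
   [Y]-valued functions in which this tensor is $t \mapsto f(t) y$. *)
Definition is_tensor_space (T : Type) (Om : set T)
    (H0 : hilbertType R) (ev0 : H0 -> T -> R[i]^o) (Y : hilbertType R)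
    (H : hilbertType R) (ev : H -> T -> Y) : Prop :=
  [/\ function_space Om ev,
      forall t, Om t -> exists M : R[i], forall f, `|ev f t| <= M * `|f|
    & exists tens : H0 -> Y -> H,
      [/\ forall f y t, Om t -> ev (tens f y) t = ev0 f t *: y,
          forall f y g x, inner (tens f y) (tens g x) = inner f g * inner y x
        & cs_set (cspan [set h | exists f y, h = tens f y]) = setT]].

(* Differentiability is over the complex field and for the operator norm, i.e.
   $S$ is holomorphic on the ball; its values outside the ball play no role.
   Such models of $\mathcal H(k_d)$, $\mathcal H_{\mathcal U}(k_d)$ and
   $\mathcal H_{\mathcal Y}(k_d)$ exist and are unique up to a unitary operator
   that preserves the functions. *)
Definition schur_class (U Y : hilbertType R) (S : 'rV[R[i]]_d -> 'L(U, Y)) :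
    Prop :=
  (forall l : ('rV[R[i]]_d : normedModType R[i]),
     unit_ball l -> differentiable S l) /\
  exists (H : hilbertType R) (ev : H -> 'rV[R[i]]_d -> R[i]^o)
         (HU : hilbertType R) (evU : HU -> 'rV[R[i]]_d -> U)
         (HY : hilbertType R) (evY : HY -> 'rV[R[i]]_d -> Y),
    [/\ is_rkhs unit_ball da_kernel ev,
        is_tensor_space unit_ball ev evU,
        is_tensor_space unit_ball ev evY
      & forall f : HU, exists2 g : HY,
          forall l, unit_ball l -> evY g l = S l (evU f l) & `|g| <= `|f|].

Definition kernel_S (U Y : hilbertType R) (S : 'rV[R[i]]_d -> 'L(U, Y)) l z :
    'L(Y, Y) :=
  da_kernel l z *: (bop_id - S l \oc (S z)^H).

Lemma zero_set_subspace (U Y : hilbertType R) (S : 'rV[R[i]]_d -> 'L(U, Y)) :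
  is_subspace [set u : U | forall l, unit_ball l -> S l u = 0].
Proof.
split=> [l _|a x y xS yS l Bl]; first exact: bop0.
by rewrite bop_linear xS// yS// scaler0 addr0.
Qed.

Lemma zero_set_closed (U Y : hilbertType R) (S : 'rV[R[i]]_d -> 'L(U, Y)) :
  closed [set u : U | forall l, unit_ball l -> S l u = 0].
Proof.
apply: closed_approx => u uS l Bl; apply: (@ker_closed _ _ _ (S l)).
by apply/closureP_lt => e /uS[s sS us]; exists s => //=; exact: sS.
Qed.

Definition null_inputs (U Y : hilbertType R) (S : 'rV[R[i]]_d -> 'L(U, Y)) :
    csubspace U :=
  CSubspace (zero_set_subspace S) (@zero_set_closed _ _ S).

End drury_arveson.

Section colligations.
Variables (R : realType) (d : nat) (U Y X : hilbertType R).
Implicit Types (l z : 'rV[R[i]]_d).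
Implicit Types (A : 'I_d -> 'L(X, X)) (B : 'L(U, hpow d X)).
Implicit Types (C : 'L(X, Y)) (D : 'L(U, Y)) (S : 'rV[R[i]]_d -> 'L(U, Y)).

Lemma Zop_linear l : linear (fun p : hpow d X => \sum_j l 0 j *: p j).
Proof.
move=> a p q /=; rewrite scaler_sumr -big_split; apply: eq_bigr => j _ /=.
by rewrite !ffunE scalerDr !scalerA [a * _]mulrC.
Qed.

Lemma Zop_bounded l :
  exists M : R[i], forall p : hpow d X, `|\sum_j l 0 j *: p j| <= M * `|p|.
Proof.
exists (\sum_j `|l 0 j|) => p; rewrite (le_trans (ler_norm_sum _ _ _))// mulr_suml.
by apply: ler_sum => j _; rewrite normrZ ler_wpM2l// hpow_norm_coord.
Qed.

Definition Zop l : 'L(hpow d X, X) := mk_bop (Zop_linear l) (Zop_bounded l).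

Definition gram A C : 'L(X, X) := \sum_j (A j)^H \oc A j + C^H \oc C.

Definition contractive_pair C A : Prop := le_op (gram A C) bop_id.
Definition isometric_pair C A : Prop := gram A C = bop_id.

Definition kernel_CA C A l z : 'L(Y, Y) :=
  C \oc bop_inv (bop_id - \sum_j l 0 j *: A j)
    \oc bop_inv (bop_id - \sum_j (z 0 j)^* *: (A j)^H) \oc C^H.

Definition colligation A B C D : 'L(hsum X U, hsum (hpow d X) Y) :=
  block_op (col_op A) B C D.

Definition realizes S A B C D : Prop :=
  forall l, unit_ball l ->
    S l = D + C \oc bop_inv (bop_id - Zop l \oc col_op A) \oc Zop l \oc B.

Definition space_D C A : csubspace (hpow d X) :=
  cspan [set p | exists z y, unit_ball z /\
    p = ((Zop z)^H \oc bop_inv (bop_id - (col_op A)^H \oc (Zop z)^H) \oc C^H) y].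

Definition space_Dperp C A : csubspace (hpow d X) := orth (cs_set (space_D C A)).

Definition weakly_coisometric C A
    (V : 'L(hsum X U, hsum (hpow d X) Y)) : Prop :=
  contractive V^H /\
  forall (p : hpow d X) (y : Y), cs_set (space_D C A) p ->
    `|V^H (p, y)| = `|(p, y) : hsum (hpow d X) Y|.

Definition is_CV S C A (CV : 'L(space_D C A, U)) : Prop :=
  forall z y (p : space_D C A), unit_ball z ->
    val p = ((Zop z)^H \oc bop_inv (bop_id - (col_op A)^H \oc (Zop z)^H) \oc C^H) y ->
    CV p = ((S z)^H - (S 0)^H) y.

Definition T11 C A : 'L(space_Dperp C A, X) := (col_op A)^H \oc cs_incl (space_Dperp C A).

Definition T12 C A : 'L(hsum (space_D C A) Y, X) :=
  row_op ((col_op A)^H \oc cs_incl (space_D C A)) C^H.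

Definition T22 S C A (CV : 'L(space_D C A, U)) : 'L(hsum (space_D C A) Y, U) :=
  row_op CV (S 0)^H.

Definition defect1 C A := bop_sqrt (bop_id - T12 C A \oc (T12 C A)^H).
Definition defect2 C A := bop_sqrt (bop_id - (T12 C A)^H \oc T12 C A).

Definition is_G1 C A (G1 : 'L(cran (defect1 C A), space_Dperp C A)) : Prop :=
  G1 \oc corestr (defect1 C A) = (T11 C A)^H.

Definition is_G2 S C A (CV : 'L(space_D C A, U))
    (G2 : 'L(cran (defect2 C A), U)) : Prop :=
  partial_isometry G2 /\ G2 \oc corestr (defect2 C A) = T22 S CV.

Definition defect3 C A (G1 : 'L(cran (defect1 C A), space_Dperp C A)) :
    'L(space_Dperp C A, space_Dperp C A) :=
  bop_sqrt (bop_id - G1 \oc G1^H).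

(* $T_{12}^*$ maps the closed range of [defect1] into that of [defect2]; [bop_proj]
   only records this in the types. *)
Definition X_of S C A (G1 : 'L(cran (defect1 C A), space_Dperp C A))
    (G2 : 'L(cran (defect2 C A), U)) (Q : 'L(cran (defect3 G1), null_inputs S)) :
    'L(space_Dperp C A, U) :=
  - (G2 \oc bop_proj (cran (defect2 C A)) \oc (T12 C A)^H
       \oc cs_incl (cran (defect1 C A)) \oc G1^H)
  + cs_incl (null_inputs S) \oc Q \oc corestr (defect3 G1).

Definition B_of S C A (CV : 'L(space_D C A, U))
    (G1 : 'L(cran (defect1 C A), space_Dperp C A))
    (G2 : 'L(cran (defect2 C A), U)) (Q : 'L(cran (defect3 G1), null_inputs S)) :
    'L(U, hpow d X) :=
  cs_incl (space_Dperp C A) \oc (X_of G2 Q)^H + cs_incl (space_D C A) \oc CV^H.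

End colligations.

(* Main.v *)
(** Take adjoints and split X^d as D^perp + D.  A realization with lower right
    corner S(0) is the same thing as an operator B whose adjoint restricts to
    C_V on D, so that U^* becomes the completion problem
      [[T11, T12], [X, T22]] : D^perp + (D + Y) -> X + U
    with the single unknown X = B^*|D^perp.  The kernel identity says that the
    second column is isometric, contractivity of (C, A) that the first row is
    contractive.  A contraction whose second column is isometric has orthogonal
    columns; since T11 = (I - T12 T12^* )^(1/2) G1^* and T12^* intertwines the two
    defect operators, orthogonality says that X = - G2 T12^* G1^* + X' with X'
    valued in Ker T22^* = U_S^0, and then
      |T11 g|^2 + |X g|^2 = |G1^* g|^2 + |X' g|^2.
    So the completion is contractive (isometric) iff |X' g| is at most (equal to)
    |(I - G1 G1^* )^(1/2) g|, that is iff X' factors through that defect operator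
    by a contraction (isometry) Q.  For an isometric pair G1 is isometric, the
    last defect space is Ker A^* in D^perp, and the completion is unitary iff Q
    is. *)

Require Import Defs.
From mathcomp Require Import all_boot all_order all_algebra.
From mathcomp Require Import all_classical all_reals all_analysis.
From mathcomp Require Import complex ring.

Set Implicit Arguments.
Unset Strict Implicit.
Unset Printing Implicit Defensive.

Import Order.TTheory GRing.Theory Num.Theory Num.Def.
Import numFieldNormedType.Exports.
Local Open Scope classical_set_scope.
Local Open Scope ring_scope.

(** * Inner products, the Riesz representation and adjoints *)

(** Adjoints, inverses and roots are choices by [xget], so existence has to come first: Riesz for
    adjoints, and for resolvents and roots an iteration dominated by a sequence of numbers. The
    chosen root keeps only its positivity and its square; the approximation that would show what it
    commutes with is lost. This is why the intertwining of the two defect operators is proved for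
    arbitrary positive roots.

    [CV] and the kernel identity say something about generators only. Such information is carried to
    closed spans by closed preimages, by sesquilinear forms, or by closing up a graph, so that no
    linear combination is ever written. The kernel identity becomes an isometry because Z(l) Z(z)^H
    is the scalar <l, z>, which accounts for the denominator, and because the generator at the
    origin is 0, which makes the pairs of a generator and its vector total in D + Y.

    Dimension conditions are turned at once into the existence of isometric or unitary operators,
    that is, of a suitable [Q]. *)

Section inner_product.
Variables (R : realType) (H : hilbertType R).
Implicit Types (x y z : H) (a : R[i]).

Let lin := @inner_linear R H.
Let cnj := @inner_conj R H.

Lemma innerZl a x y : inner (a *: x) y = a * inner x y.
Proof. exact: (@ipZl R H (@inner R H) lin). Qed.
Lemma innerDl x y z : inner (x + y) z = inner x z + inner y z.
Proof. exact: (@ipDl R H (@inner R H) lin). Qed.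
Lemma innerNl x z : inner (- x) z = - inner x z.
Proof. exact: (@ipNl R H (@inner R H) lin). Qed.
Lemma inner0l y : inner 0 y = 0 :> R[i].
Proof. exact: (@ip0l R H (@inner R H) lin). Qed.
Lemma innerDr x y z : inner z (x + y) = inner z x + inner z y.
Proof. exact: (@ipDr R H (@inner R H) lin cnj). Qed.
Lemma innerZr a x y : inner x (a *: y) = a^* * inner x y.
Proof. exact: (@ipZr R H (@inner R H) lin cnj). Qed.
Lemma innerNr x z : inner z (- x) = - inner z x.
Proof. exact: (@ipNr R H (@inner R H) lin cnj). Qed.
Lemma inner0r y : inner y 0 = 0 :> R[i].
Proof. by rewrite inner_conj inner0l rmorph0. Qed.

Definition innerE := (innerDl, innerDr, innerNl, innerNr, innerZl, innerZr,
  inner0l, inner0r).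

Lemma inner_suml I (s : seq I) (P : pred I) (F : I -> H) y :
  inner (\sum_(i <- s | P i) F i) y = \sum_(i <- s | P i) inner (F i) y.
Proof. by elim/big_rec2: _ => [|i u v _ <-]; rewrite ?inner0l ?innerDl. Qed.

Lemma inner_inj x y : (forall z, inner x z = inner y z) -> x = y.
Proof.
move=> xy; apply/eqP; rewrite -subr_eq0; apply/eqP/inner_eq0.
by rewrite innerDl innerNl xy subrr.
Qed.

Lemma inner_injr x y : (forall z, inner z x = inner z y) -> x = y.
Proof. by move=> xy; apply: inner_inj => z; rewrite inner_conj xy -inner_conj. Qed.

Lemma norm_le_inner (K : hilbertType R) x (y : K) :
  (`|x| <= `|y|) = (inner x x <= inner y y).
Proof. by rewrite !inner_norm ler_pXn2r ?nnegrE. Qed.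

Lemma norm_eq_inner (K : hilbertType R) x (y : K) :
  `|x| = `|y| <-> inner x x = inner y y.
Proof.
rewrite !inner_norm; split=> [->//|/eqP].
by rewrite eqrXn2// => /eqP.
Qed.

End inner_product.

Lemma add_conj_le (R : realType) (c : R[i]) : c + c^* <= `|c| *+ 2.
Proof.
have /lerD /(_ (Num.Theory.leif_Re_Creal c).1) := (Num.Theory.leif_Re_Creal c).1.
by rewrite -mulr2n !ReE; apply: le_trans; rewrite mulr2n -splitr.
Qed.

Section riesz.
Variables (R : realType) (H : hilbertType R) (phi : H -> R[i]).
Hypothesis phi_linear : forall a x y, phi (a *: x + y) = a * phi x + phi y.
Hypothesis phi_bounded : exists M : R[i], forall x, `|phi x| <= M * `|x|.

Let phi0 : phi 0 = 0.
Proof.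
have := phi_linear 1 0 0; rewrite scaler0 addr0 mul1r => /eqP.
by rewrite -subr_eq0 opprD addrA subrr sub0r oppr_eq0 => /eqP.
Qed.
Let phiZ a x : phi (a *: x) = a * phi x.
Proof. by rewrite -[a *: x]addr0 phi_linear phi0 addr0. Qed.
Let phiD x y : phi (x + y) = phi x + phi y.
Proof. by rewrite -[x]scale1r phi_linear mul1r scale1r. Qed.

(** If [phi] is the inner product with [l], this is |x - l|^2 - |l|^2, so the vector sought is the
    minimizer. *)
Let energy x : R[i] := inner x x - phi x - (phi x)^*.
Let renergy x : R := complex.Re (energy x).

Let energyE x : (renergy x)%:C%C = energy x.
Proof.
apply/RRe_real/CrealP; rewrite /energy !rmorphB /= conjCK -inner_conj.
by ring.
Qed.

Let energy_bounded : exists m : R, forall x, m <= renergy x.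
Proof.
have [M0 M0P] := phi_bounded; pose M : R[i] := `|M0|.
have MP x : `|phi x| <= M * `|x|.
  have M0x : 0 <= M0 * `|x| by apply: le_trans (M0P x).
  by apply: le_trans (M0P x) _; rewrite -(ger0_norm M0x) normrM normr_id.
exists (complex.Re (- M ^+ 2)) => x; rewrite -lecR energyE RRe_real; last first.
  by rewrite realN realX// normr_real.
have := add_conj_le (phi x); rewrite /energy inner_norm => px.
rewrite lerNl -subr_ge0.
have -> : M ^+ 2 = (`|x| - M) ^+ 2 - `|x| ^+ 2 + M * `|x| *+ 2 by ring.
set p := phi x in px *; set q := p^* in px *.
have -> : (`|x| - M) ^+ 2 - `|x| ^+ 2 + M * `|x| *+ 2 - - (`|x| ^+ 2 - p - q)
  = (`|x| - M) ^+ 2 + (M * `|x| *+ 2 - (p + q)) by ring.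
rewrite addr_ge0//; first by rewrite real_exprn_even_ge0// realB// normr_real.
by rewrite subr_ge0 (le_trans px)// lerMn2r MP.
Qed.

(** The terms in [phi] cancel. The energy of the midpoint is at least the infimum, so minimizing
    sequences are Cauchy. *)
Let parallelogram x y :
  inner (x - y) (x - y) = (energy x + energy y) *+ 2 - energy (2^-1 *: (x + y)) *+ 4.
Proof.
rewrite /energy !phiZ !phiD !rmorphM !rmorphD /= !innerE.
have -> : (2^-1 : R[i])^* = 2^-1 by apply/CrealP; rewrite realV realn.
by field.
Qed.

(** The shift is the best one along the complex line spanned by [h]. As it cannot go below the
    infimum, the failure of [phi h = inner h x] is controlled by the excess energy of [x], and the
    representation passes to the limit without any continuity of [energy]. *)
Let energy_shift x h : `|phi h - inner h x| ^+ 2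
  = inner h h * (energy x
    - energy (x - ((inner x h - (phi h)^* ) / inner h h) *: h)).
Proof.
have [->|h0] := eqVneq h 0.
  by rewrite phi0 !inner0l mul0r subr0 normr0 expr0n.
have hh : inner h h != 0 by apply: contra_neq h0 => /inner_eq0.
set c := inner x h - _; have cE : phi h - inner h x = - c^*.
  by rewrite /c rmorphB /= conjCK -inner_conj opprB.
have hx : inner h x = phi h + c^* by rewrite -[c^*]opprK -cE opprB addrC subrK.
have xh : inner x h = c + (phi h)^* by rewrite subrK.
clearbody c; rewrite cE normrN norm_conjC normCK /energy -scaleNr !phiD !phiZ !innerE.
rewrite !rmorphD !rmorphM !rmorphN !rmorphM !fmorphV /= -(inner_conj h h) hx xh.
by field.
Qed.

Lemma riesz : exists l, forall x, phi x = inner x l.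
Proof.
have [m0 m0P] := energy_bounded.
have hi : has_inf (range renergy).
  by split; [exists (renergy 0), 0|exists m0 => _ [x _ <-]].
pose m := inf (range renergy).
have mP x : m <= renergy x by apply: ge_inf; [exact: hi.2|exists x].
have /choice[u uP] : forall n, exists x, renergy x < m + n.+1%:R^-1.
  move=> n; have [|_ [x _ <-] xm] := @inf_adherent _ (range renergy) n.+1%:R^-1 _ hi.
    by rewrite invr_gt0 ltr0n.
  by exists x.
have mC x : m%:C%C <= energy x by rewrite -energyE lecR.
have uC n : energy (u n) < m%:C%C + n.+1%:R^-1.
  rewrite -energyE; have -> : (n.+1%:R^-1 : R[i]) = (n.+1%:R^-1)%:C%C.
    by rewrite fmorphV rmorph_nat.
  by rewrite -rmorphD ltcR.
have cauchy n k : inner (u n - u k) (u n - u k) <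
    (n.+1%:R^-1 + k.+1%:R^-1) *+ 2.
  rewrite parallelogram ltrBlDr.
  have -> : (n.+1%:R^-1 + k.+1%:R^-1) *+ 2 + energy (2^-1 *: (u n + u k)) *+ 4
    = (n.+1%:R^-1 + k.+1%:R^-1 + (energy (2^-1 *: (u n + u k)) *+ 2)) *+ 2 :> R[i].
    by ring.
  rewrite ltr_pMn2r// (lt_le_trans (ltrD (uC n) (uC k)))//.
  by rewrite addrACA addrC lerD2l -mulr2n lerMn2r mC.
have inv_le N n : (N <= n)%N -> (n.+1%:R^-1 : R[i]) <= N.+1%:R^-1.
  by move=> Nn; rewrite lef_pV2 ?posrE ?ltr0n// ler_nat.
have [e e0|l lP] := @inner_complete _ H u.
  have [|N Ne] := @complex_archi _ (e ^+ 2 / 4); first by rewrite divr_gt0// exprn_gt0.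
  exists N => i j Ni Nj; rewrite (lt_le_trans (cauchy i j))//.
  rewrite -[_ ^+ 2](@divfK _ 4)// mulr_natr (_ : 4 = 2 * 2)%N// mulrnA lerMn2r /=.
  by rewrite mulr2n lerD// (le_trans (inv_le _ _ _) (ltW Ne)).
exists l => x; apply/eqP; rewrite -subr_eq0; apply/eqP.
apply: (@eq0_approx _ (R[i])^o _ (`|x| *+ 2)) => e e0.
have [N1 lN] := lP _ e0.
have [|N2 Ne] := @complex_archi _ (e ^+ 2); first by rewrite exprn_gt0.
pose n := maxn N1 N2.
have -> : phi x - inner x l = (phi x - inner x (u n)) + inner x (u n - l).
  by rewrite innerDr innerNr addrA subrK.
rewrite mulr2n mulrDl (le_trans (ler_normD _ _))// lerD//; last first.
  rewrite (le_trans (inner_CauchySchwarz _ _))// ler_wpM2l// ltW//.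
  by rewrite -(ltr_pXn2r (n := 2)) ?nnegrE ?(ltW e0)// -inner_norm lN ?leq_maxl.
rewrite -(ler_pXn2r (n := 2)) ?nnegrE ?mulr_ge0 ?(ltW e0)// energy_shift exprMn.
rewrite inner_norm ler_wpM2l ?exprn_ge0// lerBlDr (le_trans (ltW (uC n)))//.
by rewrite addrC lerD// (le_trans (inv_le _ _ (leq_maxr N1 N2)) (ltW Ne)).
Qed.

End riesz.

Section adjoint_theory.
Variable R : realType.
Implicit Types H K L : hilbertType R.

Lemma bopD H K (T : 'L(H, K)) x y : T (x + y) = T x + T y.
Proof. by have := bop_linear T 1 x y; rewrite !scale1r. Qed.

Lemma bopN H K (T : 'L(H, K)) x : T (- x) = - T x.
Proof. by rewrite -scaleN1r bopZ scaleN1r. Qed.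

Lemma bop_addE H K (S T : 'L(H, K)) x : (S + T) x = S x + T x.
Proof. by []. Qed.

Lemma bop_oppE H K (T : 'L(H, K)) x : (- T) x = - T x.
Proof. by []. Qed.

Lemma bop_scaleE H K a (T : 'L(H, K)) x : (a *: T) x = a *: T x.
Proof. by []. Qed.

Lemma bop_compE H K L (S : 'L(K, L)) (T : 'L(H, K)) x : (S \oc T) x = S (T x).
Proof. by []. Qed.

Lemma bop_sumE H K I (s : seq I) (P : pred I) (F : I -> 'L(H, K)) x :
  (\sum_(i <- s | P i) F i) x = \sum_(i <- s | P i) F i x.
Proof. by elim/big_rec2: _ => // i u v _ <-. Qed.

(** [xget] would return 0 if there were no adjoint; the Riesz representation, applied for every
    second argument, excludes that case. *)
Lemma adjointP H K (T : 'L(H, K)) x y : inner (T x) y = inner x (T^H y).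
Proof.
rewrite /adjoint; case: xgetP => [T' _ -> //|noT].
have /choice[f fP] : forall z, exists w, forall x, inner (T x) z = inner x w.
  move=> z; apply: riesz => [a u v|]; first by rewrite bop_linear inner_linear.
  exists (`|T| * `|z|) => u; rewrite (le_trans (inner_CauchySchwarz _ _))//.
  by rewrite mulrAC ler_wpM2r// bop_norm.
have lf : linear f.
  move=> a u v; apply: inner_injr => z.
  by rewrite -fP !innerDr !innerZr !fP.
have bf : exists M : R[i], forall z, `|f z| <= M * `|z|.
  exists `|T| => z; have [->|fz0] := eqVneq (f z) 0.
    by rewrite normr0 mulr_ge0.
  rewrite -(@ler_pM2l _ `|f z|) ?normr_gt0// -expr2 -inner_norm -fP.
  rewrite -[leLHS]ger0_norm; last by rewrite fP inner_ge0.
  rewrite (le_trans (inner_CauchySchwarz _ _))// mulrA ler_wpM2r// mulrC.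
  exact: bop_norm.
by case: (noT (mk_bop lf bf)) => u v; rewrite -fP.
Qed.

Lemma adjointPr H K (T : 'L(H, K)) x y : inner y (T x) = inner (T^H y) x.
Proof. by rewrite inner_conj adjointP -inner_conj. Qed.

Lemma adjoint_unique H K (T : 'L(H, K)) (T' : 'L(K, H)) :
  (forall x y, inner (T x) y = inner x (T' y)) -> T^H = T'.
Proof.
by move=> TT'; apply: bopP_eq => y; apply: inner_injr => x; rewrite -adjointP.
Qed.

Lemma adjointK H K (T : 'L(H, K)) : T^H^H = T.
Proof. by apply: adjoint_unique => x y; rewrite -adjointPr. Qed.

Lemma adjoint_comp H K L (S : 'L(K, L)) (T : 'L(H, K)) :
  (S \oc T)^H = T^H \oc S^H.
Proof. by apply: adjoint_unique => x y; rewrite !bop_compE !adjointP. Qed.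

Lemma adjointD H K (S T : 'L(H, K)) : (S + T)^H = S^H + T^H.
Proof.
apply: adjoint_unique => x y.
by rewrite !bop_addE innerDl innerDr !adjointP.
Qed.

Lemma adjointZ H K a (T : 'L(H, K)) : (a *: T)^H = a^* *: T^H.
Proof.
apply: adjoint_unique => x y.
by rewrite !bop_scaleE innerZl innerZr adjointP conjCK.
Qed.

Lemma adjointN H K (T : 'L(H, K)) : (- T)^H = - T^H.
Proof. by rewrite -scaleN1r adjointZ rmorphN rmorph1 scaleN1r. Qed.

Lemma adjointB H K (S T : 'L(H, K)) : (S - T)^H = S^H - T^H.
Proof. by rewrite adjointD adjointN. Qed.

Lemma adjoint_id H : (@bop_id R H)^H = bop_id.
Proof. exact: adjoint_unique. Qed.

Lemma adjoint0 H K : (0 : 'L(H, K))^H = 0.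
Proof. by apply: adjoint_unique => x y; rewrite inner0l inner0r. Qed.

Lemma adjoint_sum H K I (s : seq I) (P : pred I) (F : I -> 'L(H, K)) :
  (\sum_(i <- s | P i) F i)^H = \sum_(i <- s | P i) (F i)^H.
Proof.
elim/big_rec2: _ => [|i u v _ <-]; [exact: adjoint0|exact: adjointD].
Qed.

Lemma norm_adjoint_comp H K (T : 'L(H, K)) x :
  inner ((T^H \oc T) x) x = inner (T x) (T x).
Proof. by rewrite [RHS]adjointPr. Qed.

(** Polarization with [y] and ['i *: y]. Complex scalars matter: over the reals a rotation by a
    right angle has zero form. *)
Lemma bop_eq0_form H (T : 'L(H, H)) : (forall x, inner (T x) x = 0) -> T = 0.
Proof.
move=> T0; apply: bopP_eq => x; apply: inner_inj => y.
have h1 := T0 (x + y); have h2 := T0 (x + 'i *: y).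
move: h1 h2; rewrite !bopD !bopZ !innerDl !innerDr !innerZl !innerZr !T0.
rewrite conjCi !(add0r, addr0, mulr0) => h1 h2.
rewrite [RHS]inner0l; apply: (@mulfI _ 2); first by rewrite pnatr_eq0.
move: h1 h2; set a := inner _ _; set b := inner _ _ => h1 h2.
have -> : 2 * a = (a + b) + 'i * (- 'i * a + 'i * b) + (1 + 'i ^+ 2) * (a - b) by ring.
by rewrite h1 h2 sqrCi addrN mul0r !mulr0 !addr0.
Qed.

Lemma isometricP H K (T : 'L(H, K)) : isometric T <-> T^H \oc T = bop_id.
Proof.
split=> [iT|TT x]; last first.
  by apply/norm_eq_inner; rewrite -norm_adjoint_comp TT.
apply/eqP; rewrite -subr_eq0; apply/eqP/bop_eq0_form => x.
rewrite bop_addE innerDl norm_adjoint_comp bop_oppE innerNl.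
by have /norm_eq_inner -> := iT x; rewrite subrr.
Qed.

Lemma isometric_inner H K (T : 'L(H, K)) x y :
  isometric T -> inner (T x) (T y) = inner x y.
Proof. by move=> /isometricP iT; rewrite adjointP -bop_compE iT. Qed.

Lemma contractive_adjoint H K (T : 'L(H, K)) : contractive T -> contractive T^H.
Proof.
move=> cT y; have [->|Ty0] := eqVneq (T^H y) 0; first by rewrite normr0.
rewrite -(@ler_pM2l _ `|T^H y|) ?normr_gt0// -expr2 -inner_norm -adjointP.
rewrite -[leLHS]ger0_norm; last by rewrite adjointP inner_ge0.
by rewrite (le_trans (inner_CauchySchwarz _ _))// ler_wpM2r.
Qed.

End adjoint_theory.

(** * Norm limits, inverses and square roots *)

Section operator_algebra.
Variable R : realType.
Implicit Types H K L : hilbertType R.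

Lemma bop_norm_le H K (T : 'L(H, K)) (M : R[i]) :
  0 <= M -> (forall x, `|T x| <= M * `|x|) -> `|T| <= M.
Proof. exact: opnorm_le. Qed.

Lemma bop_comp_norm H K L (S : 'L(K, L)) (T : 'L(H, K)) :
  `|S \oc T| <= `|S| * `|T|.
Proof.
apply: bop_norm_le => [|x]; first by rewrite mulr_ge0.
by rewrite -mulrA (le_trans (bop_norm S (T x)))// ler_wpM2l// bop_norm.
Qed.

Lemma adjoint_norm H K (T : 'L(H, K)) : `|T^H| <= `|T|.
Proof.
apply: bop_norm_le => // y; have [->|Ty0] := eqVneq (T^H y) 0.
  by rewrite normr0 mulr_ge0.
rewrite -(@ler_pM2l _ `|T^H y|) ?normr_gt0// -expr2 -inner_norm -adjointP.
rewrite -[leLHS]ger0_norm; last by rewrite adjointP inner_ge0.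
rewrite (le_trans (inner_CauchySchwarz _ _))// mulrA ler_wpM2r// mulrC.
exact: bop_norm.
Qed.

(** A majorant criterion: the increments are bounded by those of a bounded sequence of numbers,
    which is then increasing, and its supremum [l] bounds every tail by [l - y n]. Both iterations
    used later come with such a majorant. *)
Lemma bop_complete H K (T : nat -> 'L(H, K)) (y : nat -> R) (B : R) :
  (forall n, y n <= B) -> (forall n, `|T n.+1 - T n| <= (y n.+1 - y n)%:C%C) ->
  exists L : 'L(H, K), T @ \oo --> L.
Proof.
move=> yB Ty.
have ymono m n : (m <= n)%N -> y m <= y n.
  elim: n => [|n IHn]; first by rewrite leqn0 => /eqP->.
  rewrite leq_eqVlt => /predU1P[->//|/IHn mn]; apply: le_trans mn _.
  by rewrite -subr_ge0 -ler0c (le_trans _ (Ty n)).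
have ys : has_sup (range y) by split; [exists (y 0%N), 0%N|exists B => _ [n _ <-]].
pose l := sup (range y).
have yl n : y n <= l by apply: ub_le_sup; [exact: ys.2|exists n].
have ly (e : R[i]) : 0 < e -> exists N, (l - y N)%:C%C < e.
  move=> e0; have eE : (complex.Re e)%:C%C = e by rewrite RRe_real// gtr0_real.
  have [|_ [N _ <-] lN] := @sup_adherent _ (range y) (complex.Re e) _ ys.
    by rewrite -ltcR eE.
  by exists N; rewrite -eE ltcR ltrBlDl -ltrBlDr.
have Tmn m n : (m <= n)%N -> `|T n - T m| <= (y n - y m)%:C%C.
  elim: n => [|n IHn]; first by rewrite leqn0 => /eqP->; rewrite !subrr normr0.
  rewrite leq_eqVlt => /predU1P[->|/IHn mn]; first by rewrite !subrr normr0.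
  rewrite -(subrKA (T n)) -(subrKA (y n)) rmorphD (le_trans (ler_normD _ _))//.
  by rewrite lerD.
have Txl x m n : (m <= n)%N -> `|T n x - T m x| <= (l - y m)%:C%C * `|x|.
  move=> mn; apply: (le_trans (bop_norm (T n - T m) x)); rewrite ler_wpM2r//.
  by rewrite (le_trans (Tmn _ _ mn))// lecR lerD2r.
have /choice[f fP] : forall x, exists z, forall e : R[i], 0 < e ->
    exists N, forall n, (N <= n)%N -> `|T n x - z| < e.
  move=> x; have [e e0|z zP] := @inner_complete _ _ (fun n => T n x); last first.
    exists z => e e0; have [N NP] := zP _ e0; exists N => n /NP.
    by rewrite inner_norm ltr_pXn2r ?nnegrE// ltW.
  have x1 : 0 < (`|x| + 1) *+ 2 by rewrite pmulrn_lgt0// ltr_wpDl.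
  have [|N Ne] := ly (e / ((`|x| + 1) *+ 2)); first by rewrite divr_gt0.
  exists N => m n Nm Nn; rewrite inner_norm ltr_pXn2r ?nnegrE ?(ltW e0)//.
  have tN k : (N <= k)%N -> `|T k x - T N x| < e / 2.
    move=> /(Txl x) /le_lt_trans; apply.
    apply: (@le_lt_trans _ _ ((l - y N)%:C%C * (`|x| + 1))).
      by rewrite ler_wpM2l ?ler0c ?subr_ge0// lerDl.
    rewrite -ltr_pdivlMr; last by rewrite ltr_wpDl.
    by rewrite -mulrA -invfM mulr_natl.
  rewrite -(subrKA (T N x)) (le_lt_trans (ler_normD _ _))// [ltRHS]splitr ltrD ?tN//.
  by rewrite -opprB normrN tN.
have fT x n : `|T n x - f x| <= (l - y n)%:C%C * `|x|.
  apply/ler_addgt0Pr => e /(fP x)[N NP]; set m := maxn N n.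
  rewrite -(subrKA (T m x)) (le_trans (ler_normD _ _))// lerD//.
    by rewrite -opprB normrN Txl// leq_maxr.
  by rewrite ltW// NP// leq_maxl.
have lf : linear f.
  move=> a u v; apply/eqP; rewrite -subr_eq0; apply/eqP.
  apply: (@eq0_approx _ _ _ (`|a *: u + v| + (`|a| * `|u| + `|v|))) => e /ly[N Ne].
  have -> : f (a *: u + v) - (a *: f u + f v) = - (T N (a *: u + v) - f (a *: u + v))
     + (a *: (T N u - f u) + (T N v - f v)).
    rewrite bop_linear opprB scalerBr -[RHS]addrA; congr (_ + _).
    by rewrite addrACA -opprD addrA addNr add0r.
  rewrite mulrDl (le_trans (ler_normD _ _))// normrN lerD//.
    by rewrite (le_trans (fT _ _))// mulrC ler_wpM2l// ltW.
  rewrite mulrDl (le_trans (ler_normD _ _))// normrZ -mulrA lerD// ?ler_wpM2l//.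
    by rewrite (le_trans (fT _ _))// mulrC ler_wpM2l// ltW.
  by rewrite (le_trans (fT _ _))// mulrC ler_wpM2l// ltW.
have bf : exists M : R[i], forall x, `|f x| <= M * `|x|.
  exists (`|T 0%N| + (l - y 0%N)%:C%C) => x.
  rewrite -[f x](subrK (T 0%N x)) (le_trans (ler_normD _ _))// addrC mulrDl lerD//.
    exact: bop_norm.
  by rewrite -opprB normrN fT.
exists (mk_bop lf bf); apply/cvgrPdist_lt => e /ly[N Ne]; exists N => // n /= Nn.
rewrite distrC (le_lt_trans _ Ne)//; apply: bop_norm_le => [|x].
  by rewrite ler0c subr_ge0.
apply: le_trans (fT x n) _; rewrite ler_wpM2r// lecR lerB// ymono//.
Qed.

Lemma bop_compA H K L L' (S : 'L(L, L')) (T : 'L(K, L)) (V : 'L(H, K)) :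
  S \oc (T \oc V) = S \oc T \oc V.
Proof. exact: bopP_eq. Qed.

Lemma bop_comp1l H K (T : 'L(H, K)) : bop_id \oc T = T.
Proof. exact: bopP_eq. Qed.

Lemma bop_comp1r H K (T : 'L(H, K)) : T \oc bop_id = T.
Proof. exact: bopP_eq. Qed.

Lemma bop_comp0r H K L (S : 'L(K, L)) : S \oc (0 : 'L(H, K)) = 0.
Proof. by apply: bopP_eq => x; exact: bop0. Qed.

Lemma bop_comp0l H K L (T : 'L(H, K)) : (0 : 'L(K, L)) \oc T = 0.
Proof. exact: bopP_eq. Qed.

Lemma bop_compDl H K L (S S' : 'L(K, L)) (T : 'L(H, K)) :
  (S + S') \oc T = S \oc T + S' \oc T.
Proof. exact: bopP_eq. Qed.

Lemma bop_compDr H K L (S : 'L(K, L)) (T T' : 'L(H, K)) :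
  S \oc (T + T') = S \oc T + S \oc T'.
Proof. by apply: bopP_eq => x; rewrite /= bopD. Qed.

Lemma bop_compNl H K L (S : 'L(K, L)) (T : 'L(H, K)) : (- S) \oc T = - (S \oc T).
Proof. exact: bopP_eq. Qed.

Lemma bop_compNr H K L (S : 'L(K, L)) (T : 'L(H, K)) : S \oc (- T) = - (S \oc T).
Proof. by apply: bopP_eq => x; rewrite /= bopN. Qed.

Lemma bop_compZl H K L a (S : 'L(K, L)) (T : 'L(H, K)) :
  (a *: S) \oc T = a *: (S \oc T).
Proof. exact: bopP_eq. Qed.

Lemma bop_compZr H K L a (S : 'L(K, L)) (T : 'L(H, K)) :
  S \oc (a *: T) = a *: (S \oc T).
Proof. by apply: bopP_eq => x; rewrite /= bopZ. Qed.

Lemma cvg_bop_comp H K L (S : nat -> 'L(K, L)) (T : nat -> 'L(H, K)) S0 T0 :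
  S @ \oo --> S0 -> T @ \oo --> T0 -> (fun n => S n \oc T n) @ \oo --> S0 \oc T0.
Proof.
move=> /cvgrPdist_lt cS /cvgrPdist_lt cT; apply/cvgrPdist_lt => e e0.
(* [M] bounds [T0] and, as soon as [S n] is within 1 of [S0], also [S n]. *)
pose M := `|S0| + `|T0| + 1.
have M0 : 0 < M by rewrite ltr_wpDl ?addr_ge0.
have e2 : 0 < e / (M *+ 2) by rewrite divr_gt0// pmulrn_lgt0.
have [N _ NP] : \forall n \near \oo, `|S0 - S n| < 1 /\
    `|S0 - S n| < e / (M *+ 2) /\ `|T0 - T n| < e / (M *+ 2).
  near=> n; split; first by near: n; apply: cS.
  by split; near: n; [apply: cS|apply: cT].
exists N => // n /NP[Sn1 [Sn Tn]].
have -> : S0 \oc T0 - S n \oc T n = (S0 - S n) \oc T0 + S n \oc (T0 - T n).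
  by rewrite bop_compDl bop_compDr bop_compNl bop_compNr addrA subrK.
rewrite (le_lt_trans (ler_normD _ _))//.
have SnM : `|S n| <= M.
  rewrite -[S n](subrK S0) (le_trans (ler_normD _ _))// distrC addrC.
  by rewrite /M -addrA lerD2l ltW// (lt_le_trans Sn1)// lerDr.
have -> : e = e / (M *+ 2) * M + e / (M *+ 2) * M.
  by rewrite -mulr2n -mulrnAr divfK// gt_eqF// pmulrn_lgt0.
rewrite ler_ltD//.
  rewrite (le_trans (bop_comp_norm _ _))// ler_pM// ?(ltW Sn)//.
  by rewrite /M addrAC lerDr addr_ge0.
rewrite (le_lt_trans (bop_comp_norm _ _))// mulrC.
by rewrite (le_lt_trans (ler_wpM2l _ SnM))// ltr_pM2r.
Unshelve. all: by end_near. Qed.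

Lemma cvg_adjoint H K (T : nat -> 'L(H, K)) T0 :
  T @ \oo --> T0 -> (fun n => (T n)^H) @ \oo --> T0^H.
Proof.
move=> /cvgrPdist_lt cT; apply/cvgrPdist_lt => e /cT[N _ NP]; exists N => // n /NP.
by rewrite -adjointB; apply/le_lt_trans/adjoint_norm.
Qed.

(** Neumann series: [V n] is a partial sum and [y n] the geometric sum dominating it. The limit of
    the recursion gives a right inverse; it is a left inverse too because every partial sum commutes
    with [T]. *)
Lemma bop_inv_id_sub H (T : 'L(H, H)) (q : R) :
  q < 1 -> (forall x, `|T x| <= q%:C%C * `|x|) ->
  bop_inv (bop_id - T) \oc (bop_id - T) = bop_id /\
  (bop_id - T) \oc bop_inv (bop_id - T) = bop_id.
Proof.
move=> q1 Tq; rewrite /bop_inv; case: xgetP => [V _ []//|noV].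
(* A negative [q] forces the space to be zero, where 0 is an inverse. *)
have [q0|q0] := ltP q 0.
  have H0 x y : x = y :> H.
    suff z0 (z : H) : z = 0 by rewrite (z0 x) (z0 y).
    apply/eqP; rewrite -normr_eq0 eq_le normr_ge0 andbT.
    have := le_trans (normr_ge0 _) (Tq z).
    by rewrite nmulr_rge0// ltcR.
  by case: (noV 0); split; apply: bopP_eq => x; apply: H0.
pose V n : 'L(H, H) := iter n (fun V => bop_id + T \oc V) 0.
have VS n : V n.+1 = bop_id + T \oc V n by [].
pose y n : R := (1 - q ^+ n) / (1 - q).
have q1' : 0 < 1 - q by rewrite subr_gt0.
have VT n : V n \oc T = T \oc V n.
  elim: n => [|n IHn]; first by apply: bopP_eq => x; rewrite /= bop0.
  by rewrite VS bop_compDl bop_compDr -bop_compA IHn bop_comp1l bop_comp1r.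
have TqN : `|T| <= q%:C%C by apply: bop_norm_le => //; rewrite ler0c.
have [|n|W VW] := @bop_complete _ _ V y (1 - q)^-1.
- by move=> n; rewrite -div1r ler_pM2r ?invr_gt0// gerBl exprn_ge0.
- have -> : y n.+1 - y n = q ^+ n by rewrite /y exprS; field; rewrite gt_eqF.
  elim: n => [|n IHn].
    rewrite VS bop_comp0r addr0 subr0 expr0.
    by apply: bop_norm_le => // x; rewrite mul1r.
  rewrite !VS opprD addrACA subrr add0r -bop_compNr -bop_compDr.
  by rewrite (le_trans (bop_comp_norm _ _))// exprS rmorphM ler_pM.
have TVW : (fun n => bop_id + T \oc V n) @ \oo --> bop_id + T \oc W.
  by apply: cvgD; [exact: cvg_cst|apply: cvg_bop_comp => //; exact: cvg_cst].
have VTW : (fun n => V n \oc T) @ \oo --> W \oc T.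
  by apply: cvg_bop_comp => //; exact: cvg_cst.
have W1 : W = bop_id + T \oc W.
  apply: cvg_unique TVW; first exact: norm_hausdorff.
  by have := VW; rewrite -(cvg_shiftS V).
have WT : W \oc T = T \oc W.
  move: VTW; rewrite (funext VT : (fun n => V n \oc T) = (fun n => T \oc V n)).
  move=> /cvg_unique; apply; first exact: norm_hausdorff.
  by apply: cvg_bop_comp => //; exact: cvg_cst.
case: (noV W); split.
  by rewrite bop_compDr bop_compNr WT bop_comp1r {1}W1 addrK.
by rewrite bop_compDl bop_compNl bop_comp1l {1}W1 addrK.
Qed.

(** In [R[i]] a nonnegative number is real, so the form is real and polarization applies to the
    difference with the adjoint. *)
Lemma positive_adjoint H (T : 'L(H, H)) : positive_op T -> T^H = T.
Proof.
move=> T0; apply/eqP; rewrite -subr_eq0; apply/eqP/bop_eq0_form => x.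
rewrite bop_addE innerDl bop_oppE innerNl -adjointPr (inner_conj (T x) x).
by rewrite (CrealP (ger0_real (T0 x))) subrr.
Qed.

(* [N = 1 - V] for the limit [V] of [Y' = (W + Y^2) / 2], [W = 1 - T].  The same
   recursion on numbers, started at 0 with 1 for [W], increases and stays below 1,
   and its increments bound those of [Y] in norm. *)
Lemma sqrt_exists H (T : 'L(H, H)) : positive_op T -> le_op T bop_id ->
  exists N : 'L(H, H), [/\ positive_op N, N \oc N = T
    & forall B, B \oc T = T \oc B -> B \oc N = N \oc B].
Proof.
move=> T0 T1; pose W : 'L(H, H) := bop_id - T.
have WE x : W x = x - T x by [].
have TA := positive_adjoint T0.
have WA : W^H = W by rewrite adjointB adjoint_id TA.
have W1 : `|W| <= 1.
  apply: bop_norm_le => // x; rewrite mul1r norm_le_inner -subr_ge0.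
  (* As [W = 1 - T], 1 - W W = T + W T W + T W T, and each term is positive because 0 <= T <= 1; no
     root of [T] is needed for the bound. *)
  have -> : inner x x - inner (W x) (W x)
      = inner (T x) x + (inner (T (W x)) (W x) + inner (W (T x)) (T x)).
    have Tsym u v : inner u (T v) = inner (T u) v by rewrite adjointPr TA.
    rewrite !WE !bopD !bopN !innerDl !innerDr !innerNl !innerNr !Tsym.
    ring.
  rewrite addr_ge0 ?T0// addr_ge0 ?T0//; exact: T1.
pose Y n : 'L(H, H) := iter n (fun Y => 2^-1 *: (W + Y \oc Y)) 0.
have YS n : Y n.+1 = 2^-1 *: (W + Y n \oc Y n) by [].
pose y n : R := iter n (fun y => 2^-1 * (1 + y * y)) 0.
have yS n : y n.+1 = 2^-1 * (1 + y n * y n) by [].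
have Y00 : Y 0%N = 0 by [].
have y00 : y 0%N = 0 by [].
clearbody Y y.
have y0 n : 0 <= y n.
  by elim: n => [|n IHn]; rewrite ?y00// yS mulr_ge0// addr_ge0// mulr_ge0.
have y1 n : y n <= 1.
  elim: n => [|n IHn]; rewrite ?y00// yS ler_pdivrMl// mulr1 -[leRHS]/(1 + 1) lerD2l.
  by rewrite mulr_ile1.
have half : `|2^-1 : R[i]| = (2^-1 : R)%:C%C.
  by rewrite ger0_norm// fmorphV rmorph_nat.
have Yy n : `|Y n| <= (y n)%:C%C.
  elim: n => [|n IHn]; first by rewrite Y00 y00 normr0.
  rewrite YS yS normrZ half rmorphM ler_wpM2l ?ler0c ?invr_ge0//.
  rewrite rmorphD rmorphM (le_trans (ler_normD _ _))// lerD//.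
  by rewrite (le_trans (bop_comp_norm _ _))// ler_pM.
have [//||V YV] := @bop_complete _ _ Y y 1.
  elim=> [|n IHn].
    rewrite YS Y00 bop_comp0r addr0 yS y00 mulr0 addr0 mulr1 !subr0 normrZ half.
    by rewrite ler_piMr// ler0c invr_ge0.
  have -> : Y n.+2 - Y n.+1
    = 2^-1 *: ((Y n.+1 - Y n) \oc Y n.+1 + Y n \oc (Y n.+1 - Y n)).
    rewrite [Y n.+2]YS [X in _ - X]YS -scalerBr; congr (_ *: _).
    rewrite bop_compDl bop_compDr bop_compNl bop_compNr addrA subrK.
    by rewrite opprD addrACA subrr add0r.
  have -> : y n.+2 - y n.+1
    = 2^-1 * ((y n.+1 - y n) * y n.+1 + y n * (y n.+1 - y n)).
    by rewrite [y n.+2]yS [X in _ - X]yS; ring.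
  rewrite normrZ half rmorphM ler_wpM2l ?ler0c ?invr_ge0//.
  rewrite rmorphD !rmorphM (le_trans (ler_normD _ _))// lerD//.
    by rewrite (le_trans (bop_comp_norm _ _))// ler_pM.
  by rewrite (le_trans (bop_comp_norm _ _))// ler_pM.
have V2 : V + V = W + V \oc V.
  have := YV; rewrite -(cvg_shiftS Y) (funext YS : (fun n => Y n.+1) =
    (fun n => 2^-1 *: (W + Y n \oc Y n))) => YV2.
  have YV3 : (fun n => 2^-1 *: (W + Y n \oc Y n)) @ \oo --> 2^-1 *: (W + V \oc V).
    by apply: cvgZr; apply: cvgD; [exact: cvg_cst|exact: cvg_bop_comp].
  have VE : V = 2^-1 *: (W + V \oc V).
    by apply: cvg_unique YV2 YV3; exact: norm_hausdorff.
  by rewrite -[RHS]scale1r (splitr 1) mul1r scalerDl -VE.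
have V1 : `|V| <= 1.
  apply/ler_addgt0Pr => e e0; have /cvgrPdist_lt /(_ e e0)[N _ NP] := YV.
  rewrite -[V](subrK (Y N)) (le_trans (ler_normD _ _))// addrC lerD//.
    by rewrite (le_trans (Yy N))// lecR.
  by rewrite ltW//; apply: NP => /=.
have YA n : (Y n)^H = Y n.
  elim: n => [|n IHn]; first by rewrite Y00 adjoint0.
  rewrite YS adjointZ adjointD adjoint_comp IHn WA; congr (_ *: _).
  by apply/CrealP; rewrite realV realn.
have VA : V^H = V.
  have := cvg_adjoint YV; rewrite (funext YA : (fun n => (Y n)^H) = Y).
  by move=> /cvg_unique; apply => //; exact: norm_hausdorff.
exists (bop_id - V); split.
- move=> x; rewrite bop_addE bop_oppE innerDl innerNl subr_ge0.
  have Vr : inner (V x) x \is Num.real.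
    by apply/CrealP; rewrite -inner_conj adjointPr VA.
  rewrite (le_trans (real_ler_norm Vr))// (le_trans (inner_CauchySchwarz _ _))//.
  rewrite inner_norm expr2 ler_wpM2r// (le_trans (bop_norm _ _))//.
  by rewrite ler_piMl.
- apply: bopP_eq => x; have V2x : V x + V x = x - T x + V (V x).
    exact: (congr1 (fun F : 'L(H, H) => F x) V2).
  rewrite -[LHS]/(x - V x - V (x - V x)) bopD bopN opprD opprK addrA -addrA.
  by rewrite addrA -(addrA x) -opprD V2x opprD addrA subrK subKr.
move=> B BT; rewrite bop_compDl bop_compDr bop_compNr bop_compNl.
rewrite bop_comp1l bop_comp1r; congr (_ - _).
have BW : B \oc W = W \oc B.
  by rewrite bop_compDl bop_compDr bop_compNr bop_compNl bop_comp1l bop_comp1r BT.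
have BY n : B \oc Y n = Y n \oc B.
  elim: n => [|n IHn]; first by rewrite Y00 bop_comp0r bop_comp0l.
  rewrite YS bop_compZl bop_compZr bop_compDl bop_compDr BW.
  by rewrite bop_compA IHn -bop_compA IHn bop_compA.
have : (fun n => B \oc Y n) @ \oo --> B \oc V.
  by apply: cvg_bop_comp => //; exact: cvg_cst.
move=> /cvg_unique; apply; first exact: norm_hausdorff.
rewrite (funext BY : (fun n => B \oc Y n) = (fun n => Y n \oc B)).
by apply: cvg_bop_comp => //; exact: cvg_cst.
Qed.

End operator_algebra.

(** * Positive square roots and intertwining operators *)

Section positive_roots.
Variable R : realType.
Implicit Types H K L : hilbertType R.

(** Commutation with other operators is not part of what [bop_sqrt] selects by; [sqrt_intertwine]
    recovers it from the two properties kept here. *)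
Lemma bop_sqrtP H (T : 'L(H, H)) : positive_op T -> le_op T bop_id ->
  positive_op (bop_sqrt T) /\ bop_sqrt T \oc bop_sqrt T = T.
Proof.
move=> T0 T1; rewrite /bop_sqrt; case: xgetP => // noN.
by have [N [N0 NN _]] := sqrt_exists T0 T1; case: (noN N).
Qed.

(** [M] is scaled below the identity, with the 1 in [c] guarding against [M = 0]. The factor is left
    in place, since kernels, signs and commutation do not see it. *)
Lemma positive_root H (M : 'L(H, H)) : positive_op M ->
  exists (c : R[i]) (N : 'L(H, H)), [/\ 0 < c, positive_op N, N \oc N = c *: M
    & forall B, B \oc M = M \oc B -> B \oc N = N \oc B].
Proof.
move=> M0; have M1 : 0 < `|M| + 1 by rewrite ltr_wpDl.
pose c := (`|M| + 1)^-1; have c0 : 0 < c by rewrite invr_gt0.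
have cM0 : positive_op (c *: M).
  by move=> x; rewrite bop_scaleE innerZl mulr_ge0 ?M0// ltW.
have [|N [N0 NN NC]] := sqrt_exists cM0; last first.
  by exists c, N; split=> // B BM; apply: NC; rewrite bop_compZr BM bop_compZl.
move=> x; rewrite bop_addE bop_oppE bop_scaleE innerDl innerNl innerZl subr_ge0.
rewrite ler_pdivrMl// -(ger0_norm (M0 x)) (le_trans (inner_CauchySchwarz _ _))//.
rewrite inner_norm expr2 mulrA ler_wpM2r// (le_trans (bop_norm _ _))//.
by rewrite ler_wpM2r// lerDl.
Qed.

Lemma positive_form0 H (M : 'L(H, H)) x :
  positive_op M -> inner (M x) x = 0 -> M x = 0.
Proof.
move=> M0 Mx; have [c [N [c0 N0 NN _]]] := positive_root M0.
have NA := positive_adjoint N0.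
have Nx : N x = 0.
  apply: inner_eq0.
  by rewrite -norm_adjoint_comp NA NN bop_scaleE innerZl Mx mulr0.
have : (c *: M) x = 0 by rewrite -NN /= Nx bop0.
move=> /eqP; rewrite bop_scaleE scaler_eq0 gt_eqF//= => /eqP//.
Qed.

(* With [D := M S - S N], [M D = - D N] makes [D^H D] commute with [N] while
   [D^H D N = - D^H M D] is negative; a root of [D^H D] shows that it is also
   positive, so [M D = D N = 0] and [D D^H D = 0]. *)
Lemma sqrt_intertwine H K (M : 'L(K, K)) (N : 'L(H, H)) (S : 'L(H, K)) :
  positive_op M -> positive_op N ->
  M \oc M \oc S = S \oc (N \oc N) -> M \oc S = S \oc N.
Proof.
move=> M0 N0 MS; pose D := M \oc S - S \oc N.
have MA := positive_adjoint M0; have NA := positive_adjoint N0.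
have MD x : M (D x) = - D (N x).
  have /(congr1 (fun F : 'L(H, K) => F x)) MSx := MS.
  rewrite -[D x]/(M (S x) - S (N x)) -[D (N x)]/(M (S (N x)) - S (N (N x))).
  by rewrite bopD bopN opprB; congr (_ - _); exact: MSx.
pose Q := D^H \oc D.
have Q0 : positive_op Q by move=> x; rewrite norm_adjoint_comp inner_ge0.
have QN : Q \oc N = - (D^H \oc M \oc D).
  by apply: bopP_eq => x; rewrite /= -[_ (N x)]opprK -MD bopN.
have NQ : N \oc Q = Q \oc N.
  have QA : Q^H = Q by exact: positive_adjoint.
  rewrite -{1}NA -{1}QA -adjoint_comp QN adjointN !adjoint_comp adjointK MA.
  by rewrite bop_compA.
have [c [q [c0 q0 qq qC]]] := positive_root Q0.
have qA := positive_adjoint q0.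
have MD0 x : M (D x) = 0.
  apply: positive_form0 => //; apply/eqP; rewrite eq_le M0 andbT.
  have -> : inner (M (D x)) (D x) = - inner ((Q \oc N) x) x.
    by rewrite QN bop_oppE innerNl opprK [RHS]inner_conj [RHS]/= -adjointP -inner_conj.
  rewrite oppr_le0 -(pmulr_rge0 _ c0) -innerZl.
  have -> : c *: (Q \oc N) x = q ((N \oc q) x).
    by rewrite (qC N NQ) -[RHS]/((q \oc q) (N x)) qq.
  by rewrite adjointP qA; exact: N0.
have DN0 x : D (N x) = 0 by rewrite -[LHS]opprK -MD MD0 oppr0.
have DA y : D^H y = S^H (M y) - N (S^H y).
  by rewrite adjointB !adjoint_comp MA NA.
have D0 x : D x = 0.
  have DDD : D (D^H (D x)) = 0 by rewrite DA MD0 bop0 sub0r bopN DN0 oppr0.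
  have DD : D^H (D x) = 0.
    by apply: inner_eq0; rewrite -adjointP DDD inner0l.
  by apply: inner_eq0; rewrite adjointP DD inner0r.
by apply/eqP; rewrite -subr_eq0; apply/eqP/bopP_eq.
Qed.

End positive_roots.

(** * Closed subspaces and factorizations *)

Section subspaces.
Variable R : realType.
Implicit Types H K L : hilbertType R.

Lemma cs_norm H (D : csubspace H) (x : D) : `|x| = `|val x|.
Proof. by apply/norm_eq_inner. Qed.

Lemma cs_innerE H (D : csubspace H) (x y : D) : inner x y = inner (val x) (val y).
Proof. by []. Qed.

Lemma cs_mem H (D : csubspace H) (x : D) : cs_set D (val x).
Proof. exact/set_mem/cs_valP. Qed.

Lemma cs_inclE H (D : csubspace H) (x : D) : cs_incl D x = val x.
Proof. by []. Qed.

Lemma cs_lift H (D : csubspace H) x : cs_set D x -> exists y : D, val y = x.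
Proof. by move=> /mem_set Dx; exists (CsElt (Dx : x \in cs_pred D)). Qed.

Lemma cs_incl_isometric H (D : csubspace H) : isometric (cs_incl D).
Proof. by move=> x; rewrite cs_norm. Qed.

Lemma bop_proj_incl H (D : csubspace H) : bop_proj D \oc cs_incl D = bop_id.
Proof. exact/isometricP/cs_incl_isometric. Qed.

Lemma bop_proj_orth H (D : csubspace H) x :
  cs_set (orth (cs_set D)) (x - val (bop_proj D x)).
Proof.
move=> y /cs_lift[z <-].
by rewrite innerDl innerNl -[val z]/(cs_incl D z) adjointPr -cs_innerE subrr.
Qed.

Lemma bop_proj_val H (D : csubspace H) x :
  cs_set D x -> val (bop_proj D x) = x.
Proof.
move=> /cs_lift[y <-].
by rewrite -[bop_proj D _]/((bop_proj D \oc cs_incl D) y) bop_proj_incl.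
Qed.

Lemma bop_proj_orth0 H (D : csubspace H) x :
  cs_set (orth (cs_set D)) x -> bop_proj D x = 0.
Proof.
move=> xD; apply: inner_inj => y; rewrite -adjointPr inner0l.
exact/xD/cs_mem.
Qed.

Lemma orth_eq0 H (D : csubspace H) :
  (forall x, cs_set (orth (cs_set D)) x -> x = 0) -> cs_set D = setT.
Proof.
move=> D0; apply/seteqP; split=> // x _.
have := D0 _ (@bop_proj_orth _ D x) => /eqP; rewrite subr_eq0 => /eqP->.
exact: cs_mem.
Qed.

Lemma cspan_sub H (G : set H) (D : csubspace H) :
  G `<=` cs_set D -> cs_set (cspan G) `<=` cs_set D.
Proof.
move=> GD; have <- : closure (cs_set D) = cs_set D.
  exact/esym/closure_id/cs_closed.
apply: closure_subset => x; apply; split=> //; exact: cs_subspace.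
Qed.

Lemma sub_cspan H (G : set H) : G `<=` cs_set (cspan G).
Proof. by move=> x Gx; apply: subset_closure => D [_]; apply. Qed.

Lemma preim_subspace H K (T : 'L(H, K)) (D : csubspace K) :
  is_subspace [set x | cs_set D (T x)].
Proof.
have [D0 DD] := cs_subspace D.
by split=> [|a x y Dx Dy] /=; rewrite ?bop0// bop_linear; exact: DD.
Qed.

Lemma preim_closed H K (T : 'L(H, K)) (D : csubspace K) :
  closed [set x | cs_set D (T x)].
Proof.
apply: closed_approx => x xD; apply/(cs_closed (c := D))/closureP_lt => e e0.
have T1 : 0 < `|T| + 1 by rewrite ltr_wpDl.
have [|s Ds xs] := xD (e / (`|T| + 1)); first by rewrite divr_gt0.
exists (T s) => //; rewrite -bopN -bopD (le_lt_trans (bop_norm _ _))//.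
rewrite ltr_pdivlMr// in xs; apply: le_lt_trans xs.
by rewrite mulrC ler_wpM2l// lerDl.
Qed.

(** As a closed subspace it reduces a claim about the image of a whole closed span to one about
    generators. *)
Definition bop_preim H K (T : 'L(H, K)) (D : csubspace K) : csubspace H :=
  CSubspace (preim_subspace T D) (@preim_closed _ _ T D).

Lemma bop_cspan H K (T : 'L(H, K)) (G : set H) (D : csubspace K) x :
  (forall y, G y -> cs_set D (T y)) -> cs_set (cspan G) x -> cs_set D (T x).
Proof. by move=> GD; apply: (@cspan_sub _ G (bop_preim T D)). Qed.

(** Two passes, one for each argument, the second through conjugation. This is how Gram identities
    on generators become identities of norms. *)
Lemma cspan_form0 H (F : 'L(H, H)) (G : set H) :
  (forall p q, G p -> G q -> inner (F p) q = 0) ->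
  forall p q, cs_set (cspan G) p -> cs_set (cspan G) q -> inner (F p) q = 0.
Proof.
move=> F0 p q pG qG.
have pF y : G y -> inner (F p) y = 0.
  move=> Gy; rewrite -[y]/(bop_id y) in Gy *.
  by apply: (@bop_cspan _ _ F _ (orth [set y])) pG _ _ => // z Gz w ->; apply: F0.
rewrite inner_conj; apply/eqP; rewrite conjC_eq0; apply/eqP.
have : cs_set (orth [set F p]) (bop_id q).
  apply: bop_cspan qG => y Gy z ->.
  by rewrite inner_conj pF// rmorph0.
exact.
Qed.

(** [G] is the graph of the operator to be built: the estimate makes it single-valued and bounded,
    and together with closedness it turns the density of first components into all of [H]. *)
Lemma graph_extend H K (G : csubspace (hsum H K)) (M : R[i]) :
  (forall p, cs_set G p -> `|p.2| <= M * `|p.1|) ->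
  (forall x (e : R[i]), 0 < e -> exists2 p, cs_set G p & `|x - p.1| < e) ->
  exists T : 'L(H, K), forall x, cs_set G (x, T x).
Proof.
move=> GM Gd; have GM' p : cs_set G p -> `|p.2| <= `|M| * `|p.1|.
  move=> /GM pM; have M0 : 0 <= M * `|p.1| by apply: le_trans pM.
  by apply: le_trans pM _; rewrite -(ger0_norm M0) normrM normr_id.
have GB p q : cs_set G p -> cs_set G q -> cs_set G (p - q).
  by move=> Gp Gq; rewrite addrC -scaleN1r; apply: (cs_subspace G).2.
have /choice[f fP] : forall x, exists y, cs_set G (x, y).
  move=> x; have n0 n : 0 < (n.+1%:R^-1 : R[i]) by rewrite invr_gt0 ltr0n.
  have /choice[u uP] : forall n, exists p, cs_set G p /\ `|x - p.1| < n.+1%:R^-1.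
    by move=> n; have [p] := Gd x _ (n0 n); exists p.
  (* On [G] the norm of a pair is at most [1 + |M|] times that of its first component, so
     approximating [x] yields a Cauchy sequence of pairs. *)
  have M1 : 0 < 1 + `|M| by rewrite ltr_wpDr.
  have inv_le N n : (N <= n)%N -> (n.+1%:R^-1 : R[i]) <= N.+1%:R^-1.
    by move=> Nn; rewrite lef_pV2 ?posrE ?ltr0n// ler_nat.
  have [e e0|l lP] := @inner_complete _ _ u.
    have [|N Ne] := @complex_archi _ (e / (1 + `|M|) / 2).
      by rewrite !divr_gt0.
    exists N => m n Nm Nn; rewrite inner_norm ltr_pXn2r ?nnegrE ?(ltW e0)//.
    rewrite (le_lt_trans (hsum_norm_le _))//.
    have Gmn : cs_set G (u m - u n) by apply: GB; [exact: (uP m).1|exact: (uP n).1].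
    apply: (@le_lt_trans _ _ ((1 + `|M|) * `|(u m - u n).1|)).
      by rewrite mulrDl mul1r lerD2l GM'.
    rewrite mulrC -ltr_pdivlMr//.
    have -> : (u m - u n).1 = (x - (u n).1) - (x - (u m).1).
      by rewrite opprB [RHS]addrC addrA subrK.
    rewrite (le_lt_trans (ler_normB _ _))// (splitr (e / _)) ltrD// (lt_trans (uP _).2)//;
      exact: le_lt_trans (inv_le _ _ _) Ne.
  have Gl : cs_set G l.
    apply/(cs_closed (c := G))/closureP_lt => e /[dup] e0 /lP[N NP].
    exists (u N); first exact: (uP N).1.
    by rewrite distrC -(ltr_pXn2r (n := 2)) ?nnegrE ?(ltW e0)// -inner_norm NP.
  exists l.2; suff <- : l.1 = x by case: (l) Gl.
  apply/eqP; rewrite -subr_eq0; apply/eqP.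
  apply: (@eq0_approx _ _ _ 2) => e e0; have [N1 N1P] := lP _ e0.
  have [N2 N2P] := complex_archi e0; pose n := maxn N1 N2.
  have -> : l.1 - x = (l - u n).1 - (x - (u n).1) by rewrite opprB addrA subrK.
  rewrite mulr2n mulrDl mul1r (le_trans (ler_normB _ _))// lerD//; last first.
    by rewrite (le_trans (ltW (uP n).2))// (le_trans (inv_le N2 _ _) (ltW N2P))// leq_maxr.
  rewrite (le_trans (hsum_norm_fst _))// ltW// distrC.
  by rewrite -(ltr_pXn2r (n := 2)) ?nnegrE ?(ltW e0)// -inner_norm N1P// leq_maxl.
have fE x y : cs_set G (x, y) -> y = f x.
  move=> Gxy; have := GM' _ (GB _ _ Gxy (fP x)); rewrite /= subrr normr0 mulr0.
  by rewrite normr_le0 subr_eq0 => /eqP.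
have lf : linear f.
  by move=> a x y; apply/esym/fE; apply: ((cs_subspace G).2 a _ _ (fP x) (fP y)).
have bf : exists M : R[i], forall x, `|f x| <= M * `|x|.
  by exists M => x; exact: (GM _ (fP x)).
by exists (mk_bop lf bf).
Qed.

End subspaces.

(** * Operators prescribed on a dense set *)

Section factorization.
Variable R : realType.
Implicit Types H K L : hilbertType R.

Definition fst_op H K : 'L(hsum H K, H) := row_op bop_id 0.

Definition snd_op H K : 'L(hsum H K, K) := row_op 0 bop_id.

Lemma fst_opE H K (p : hsum H K) : fst_op H K p = p.1.
Proof. exact: addr0. Qed.

Lemma snd_opE H K (p : hsum H K) : snd_op H K p = p.2.
Proof. exact: add0r. Qed.

Lemma cspan_image_dense H K (T : 'L(H, K)) (G : set H) y :
  cs_set (cspan (T @` G)) y ->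
  forall e : R[i], 0 < e -> exists2 p, cs_set (cspan G) p & `|y - T p| < e.
Proof.
have sT : is_subspace (T @` cs_set (cspan G)).
  have [G0 GG] := cs_subspace (cspan G).
  split=> [|a _ _ [x Gx <-] [z Gz <-]]; first by exists 0; rewrite ?bop0.
  by exists (a *: x + z); [exact: GG|rewrite bop_linear].
have sub : T @` G `<=` cs_set (closure_cs sT).
  by move=> _ [x Gx <-]; apply: subset_closure; exists x => //; exact: sub_cspan.
move=> /(cspan_sub sub) /closureP_lt yT e /yT[_ [p Gp <-] yp].
by exists p.
Qed.

(** The form |p.1|^2 - |p.2|^2 vanishes on the pairs [(g i, h i)], hence on their closed span, which
    is therefore the graph of an isometry. *)
Lemma gram_isometry H K (I : Type) (g : I -> H) (h : I -> K) :
  (forall i j, inner (g i) (g j) = inner (h i) (h j)) ->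
  cs_set (cspan (range g)) = setT ->
  exists2 T : 'L(H, K), isometric T & forall i, T (g i) = h i.
Proof.
move=> gh gT; pose G : set (hsum H K) := range (fun i => (g i, h i)).
pose F := (fst_op H K)^H \oc fst_op H K - (snd_op H K)^H \oc snd_op H K.
have FE p q : inner (F p) q = inner p.1 q.1 - inner p.2 q.2.
  by rewrite bop_addE bop_oppE innerDl innerNl -!adjointPr !fst_opE !snd_opE.
have eqG p : cs_set (cspan G) p -> `|p.1| = `|p.2|.
  move=> Gp; apply/norm_eq_inner/eqP; rewrite -subr_eq0 -FE; apply/eqP.
  apply: (cspan_form0 _ Gp Gp) => _ _ [i _ <-] [j _ <-].
  by rewrite FE /= gh subrr.
have [p Gp|x e e0|T TG] := @graph_extend _ H K (cspan G) 1.
- by rewrite mul1r eqG.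
- suff [p Gp] : exists2 p, cs_set (cspan G) p & `|x - fst_op H K p| < e.
    by exists p; rewrite -?fst_opE.
  apply: (@cspan_image_dense _ _ (fst_op H K) G x _ e e0).
  suff -> : fst_op H K @` G = range g by rewrite gT.
  apply/seteqP; split=> [_ [_ [i _ <-] <-]|_ [i _ <-]].
    by rewrite fst_opE; exists i.
  by exists (g i, h i); [exists i|rewrite fst_opE].
exists T => [x|i]; first by rewrite -(eqG _ (TG x)).
have : cs_set (cspan G) ((-1) *: (g i, h i) + (g i, T (g i))).
  by apply: (cs_subspace (cspan G)).2 => //; apply: sub_cspan; exists i.
move=> /eqG /=; rewrite !scaleN1r addNr normr0 => /esym/eqP.
by rewrite normr_eq0 addrC subr_eq0 => /eqP.
Qed.

Lemma corestrE H K (T : 'L(H, K)) x : val (corestr T x) = T x.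
Proof. by []. Qed.

Lemma corestr_dense H K (T : 'L(H, K)) (x : cran T) (e : R[i]) :
  0 < e -> exists h, `|x - corestr T h| < e.
Proof.
move=> e0; have /closureP_lt /(_ _ e0)[_ [h _ <-] xh] := cs_mem x.
by exists h; rewrite cs_norm.
Qed.

Lemma corestr_adjoint_inj H K (T : 'L(H, K)) (x : cran T) :
  (corestr T)^H x = 0 -> x = 0.
Proof.
move=> Tx; apply: inner_eq0; apply: (@eq0_approx _ (R[i])^o _ `|x|) => e e0.
have [h xh] := corestr_dense x e0.
have -> : inner x x = inner x (x - corestr T h).
  by rewrite innerDr innerNr adjointPr Tx inner0l subr0.
by rewrite (le_trans (inner_CauchySchwarz _ _))// ler_wpM2l// ltW.
Qed.

Lemma corestr_adjoint_mono H K L (T : 'L(H, K)) (E : 'L(L, cran T)) :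
  (corestr T)^H \oc E = 0 -> E = 0.
Proof.
move=> E0; apply: bopP_eq => x; apply: (@corestr_adjoint_inj _ _ T (E x)).
by rewrite -bop_compE E0.
Qed.

(** [corestr T] has dense range, so its adjoint is injective; this is the uniqueness half of
    factoring through [T]. *)
Lemma corestr_epi H K L (T : 'L(H, K)) (P Q : 'L(cran T, L)) :
  P \oc corestr T = Q \oc corestr T -> P = Q.
Proof.
move=> PQ; rewrite -[P]adjointK -[Q]adjointK; congr adjoint.
apply: bopP_eq => y; apply/eqP; rewrite -subr_eq0; apply/eqP.
apply: (@corestr_adjoint_inj _ _ T); rewrite bopD bopN.
have := congr1 (fun F : 'L(H, L) => F^H y) PQ; rewrite !adjoint_comp /= => ->.
by rewrite subrr.
Qed.

Lemma corestr_adjoint H K (T : 'L(H, K)) :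
  (corestr T)^H = T^H \oc cs_incl (cran T).
Proof. by apply: adjoint_unique => x y; rewrite -adjointP. Qed.

(** The Douglas factorization: the closure of all pairs [(T h, X h)] is the graph of a
    contraction. *)
Lemma factor_corestr H K L (T : 'L(H, K)) (X : 'L(H, L)) :
  (forall h, `|X h| <= `|T h|) ->
  exists2 Q : 'L(cran T, L), contractive Q & Q \oc corestr T = X.
Proof.
move=> XT; pose G := cran (pair_op (corestr T) X).
have GP p : cs_set G p -> forall e : R[i], 0 < e ->
    exists h, `|p.1 - corestr T h| < e /\ `|p.2 - X h| < e.
  move=> /closureP_lt Gp e /Gp[_ [h _ <-] ph]; exists h; split.
    exact: (le_lt_trans (hsum_norm_fst (p - pair_op (corestr T) X h)) ph).
  exact: (le_lt_trans (hsum_norm_snd (p - pair_op (corestr T) X h)) ph).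
have G1 p : cs_set G p -> `|p.2| <= 1 * `|p.1|.
  move=> Gp; rewrite mul1r; apply/ler_addgt0Pr => e e0.
  have [|h [h1 h2]] := GP _ Gp (e / 2); first by rewrite divr_gt0.
  rewrite -[p.2](subrK (X h)) (le_trans (ler_normD _ _))// [leLHS]addrC.
  rewrite (splitr e) addrA lerD ?(ltW h2)// (le_trans (XT h))//.
  rewrite -corestrE -cs_norm -[corestr T h](subrK p.1) (le_trans (ler_normD _ _))//.
  by rewrite [leLHS]addrC lerD2l distrC ltW.
have [x e e0|Q QG] := graph_extend G1.
  have [h xh] := corestr_dense x e0.
  by exists (corestr T h, X h) => //; apply: subset_closure; exists h.
exists Q => [x|]; first by have := G1 _ (QG x); rewrite mul1r.
apply: bopP_eq => h.
have : cs_set G ((-1) *: (corestr T h, X h) + (corestr T h, Q (corestr T h))).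
  by apply: (cs_subspace G).2 => //; apply: subset_closure; exists h.
move=> /G1 /=; rewrite !scaleN1r addNr normr0 mulr0 normr_le0 addrC subr_eq0.
by move=> /eqP.
Qed.

Lemma contractive_corestr H K L (T : 'L(H, K)) (Q : 'L(cran T, L)) :
  contractive Q <-> forall h, `|Q (corestr T h)| <= `|T h|.
Proof.
split=> [Qc h|Qc]; first by rewrite (le_trans (Qc _))// cs_norm.
by have [P Pc /corestr_epi <-] := @factor_corestr _ _ _ T (Q \oc corestr T) Qc.
Qed.

(** Between [corestr T] and its adjoint, [Q^H \oc Q - bop_id] becomes an operator on [H] with zero
    form; injectivity of the adjoint and density then remove the two factors. *)
Lemma isometric_corestr H K L (T : 'L(H, K)) (Q : 'L(cran T, L)) :
  isometric Q <-> forall h, `|Q (corestr T h)| = `|T h|.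
Proof.
split=> [Qi h|Qi]; first by rewrite Qi cs_norm.
apply/isometricP/corestr_epi; apply/eqP; rewrite -subr_eq0; apply/eqP.
set D := _ - _; apply: corestr_adjoint_mono.
apply: bop_eq0_form => h; rewrite bop_compE -adjointPr /D bop_addE bop_oppE.
rewrite innerDl innerNl bop_compE norm_adjoint_comp bop_comp1l cs_innerE.
by have /norm_eq_inner <- := Qi h; rewrite subrr.
Qed.

End factorization.

(** * Orthonormal bases *)

Section dimension.
Variable R : realType.
Implicit Types H K L : hilbertType R.

Definition orthonormal H (e : set H) : Prop :=
  (forall x, e x -> `|x| = 1) /\
  (forall x y, e x -> e y -> x <> y -> inner x y = 0).

Lemma orthonormal_extend H (e : set H) :
  orthonormal e -> exists2 f, e `<=` f & orthonormal_basis f.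
Proof.
move=> oe.
(* Zorn also asks about the empty chain, whose union is empty; ordering the parts [A] to be added,
   rather than the supersets of [e], makes that case hold. *)
have [F FP Ft|A [oA Amax]] := @Zorn_bigcup H [set A | orthonormal (e `|` A)].
  split=> [x [ex|[B FB Bx]]|x y]; first exact: oe.1.
    by apply: (FP B FB).1; right.
  move=> [ex|[B FB Bx]] [ey|[D FD Dy]].
  - exact: oe.2.
  - by apply: (FP D FD).2; [left|right].
  - by apply: (FP B FB).2; [right|left].
  have [BD|DB] := Ft B D FB FD.
    by apply: (FP D FD).2; right => //; exact: BD.
  by apply: (FP B FB).2; right => //; exact: DB.
exists (e `|` A); first exact: subsetUl.
split; [exact: oA.1|exact: oA.2|].
apply: orth_eq0 => z zA; apply/eqP/negPn/negP => z0.
have zn : `|z| != 0 by rewrite normr_eq0.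
pose v := `|z|^-1 *: z.
have v1 : `|v| = 1 by rewrite normrZ ger0_norm ?invr_ge0// mulVf.
have vA x : (e `|` A) x -> inner v x = 0.
  by move=> Ax; rewrite innerZl zA ?mulr0//; exact: sub_cspan.
have vNA : ~ (e `|` A) v.
  move=> /vA; rewrite inner_norm v1 expr1n => /eqP; rewrite oner_eq0//.
apply: (Amax (v |` A)).
  rewrite properEneq; split; last exact: subsetUr.
  apply/eqP => AE; apply: vNA; right; rewrite AE; left; reflexivity.
have cases x : (e `|` (v |` A)) x -> x = v \/ (e `|` A) x.
  by case=> [ex|[->|Ax]]; [right; left|left|right; right].
split=> [x /cases[->//|]|x y /cases[->|Ax] /cases[->|Ay] xy]; first exact: oA.1.
- by [].
- exact: vA.
- by rewrite inner_conj vA// rmorph0.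
- exact: oA.2.
Qed.

Lemma orthonormal_basis_exists H : exists e : set H, orthonormal_basis e.
Proof. by have [|e] := @orthonormal_extend H set0; [split|exists e]. Qed.

Lemma isometric_orthonormal H K (T : 'L(H, K)) (e : set H) :
  isometric T -> orthonormal_basis e -> orthonormal (T @` e).
Proof.
move=> Ti [e1 e0 _]; split=> [_ [x ex <-]|_ _ [x ex <-] [y ey <-] xy].
  by rewrite Ti e1.
by rewrite isometric_inner// e0// => xy'; apply: xy; rewrite xy'.
Qed.

Lemma isometric_inj H K (T : 'L(H, K)) : isometric T -> injective T.
Proof.
move=> Ti x y Txy; apply/eqP; rewrite -subr_eq0 -normr_eq0 -Ti bopD bopN Txy.
by rewrite subrr normr0.
Qed.

Lemma basis_isometry H K (e : set H) (f : set K) (g : H -> K) :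
  orthonormal_basis e -> orthonormal_basis f ->
  (forall x, e x -> f (g x)) -> {in e &, injective g} ->
  exists2 T : 'L(H, K), isometric T & forall x, e x -> T x = g x.
Proof.
move=> [e1 e0 eT] [f1 f0 _] gf gi.
have [||T Ti TE] := @gram_isometry _ H K {x | e x} sval (g \o sval).
- move=> [x ex] [y ey] /=; have [->|/eqP xy] := eqVneq x y.
    by rewrite !inner_norm e1// f1//; exact: gf.
  by rewrite e0// f0//; [exact: gf|exact: gf|move=> /gi; rewrite !inE => /(_ ex ey)].
- suff -> : range (sval : {x | e x} -> H) = e by [].
  by apply/seteqP; split=> [_ [[x ex] _ <-]//|x ex]; exists (exist _ x ex).
by exists T => // x ex; exact: (TE (exist _ x ex)).
Qed.

(* No comparison of different bases of one space is needed: a basis of [K] may be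
   chosen to extend the image of a basis of [H]. *)
Lemma dim_leP H K : dim_le H K <-> exists T : 'L(H, K), isometric T.
Proof.
split=> [[e [f [be bf /pcard_leP[g]]]]|[T Ti]].
  have [||T Ti _] := @basis_isometry H K e f g be bf; last by exists T.
  - by move=> x ex; apply: funS.
  - exact: inj.
have [e be] := orthonormal_basis_exists H.
have [f Tf bf] := orthonormal_extend (isometric_orthonormal Ti be).
exists e, f; split=> //; apply: card_le_trans (subset_card_le Tf).
have : (T @` e #= e)%card.
  by apply: inj_card_eq => x y _ _; exact: isometric_inj.
by rewrite card_eq_le => /andP[].
Qed.

Lemma unitaryP H K (T : 'L(H, K)) :
  unitary T <-> T^H \oc T = bop_id /\ T \oc T^H = bop_id.
Proof.
have adjK : isometric T^H <-> T \oc T^H = bop_id.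
  by rewrite -{2}[T]adjointK; exact: isometricP.
by split=> -[/isometricP ? /adjK ?].
Qed.

Lemma unitary_adjoint H K (T : 'L(H, K)) : unitary T -> unitary T^H.
Proof. by move=> [T1 T2]; split=> //; rewrite /coisometric adjointK. Qed.

Lemma unitary_comp H K L (S : 'L(K, L)) (T : 'L(H, K)) :
  unitary S -> unitary T -> unitary (S \oc T).
Proof.
move=> [S1 S2] [T1 T2]; split=> x; first by rewrite /= S1 T1.
by rewrite adjoint_comp /= T2 S2.
Qed.

Lemma dim_eqP H K : dim_eq H K <-> exists T : 'L(H, K), unitary T.
Proof.
split=> [[e [f [be bf /card_set_bijP[g [gf gi gs]]]]]|[T [Ti Tc]]].
  have [T Ti TE] := basis_isometry be bf gf gi.
  exists T; apply/unitaryP; have /isometricP TT := Ti; split=> //.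
  apply/eqP; rewrite -subr_eq0; apply/eqP/bopP_eq => y.
  have : cs_set (cspan f) y by have [_ _ ->] := bf.
  (* The isometry maps [e] onto [f], so [T \oc T^H] fixes [f], and the vectors it fixes form a
     closed subspace. *)
  apply: (@cspan_sub _ _ f (bop_ker (T \oc T^H - bop_id))) => z fz.
  have [x ex <-] := gs _ fz.
  have TTx : T^H (T x) = x := congr1 (fun F : 'L(H, H) => F x) TT.
  by rewrite -TE//; suff : T (T^H (T x)) - T x = 0 by []; rewrite TTx subrr.
have [e be] := orthonormal_basis_exists H.
have /unitaryP[TT TT'] : unitary T by [].
exists e, (T @` e); split=> //; last first.
  rewrite card_eq_sym; apply: inj_card_eq => x y _ _; exact: isometric_inj.
have [n1 n0] := isometric_orthonormal Ti be; split=> //.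
apply/seteqP; split=> // y _; rewrite -[y]/(bop_id y) -TT'.
apply: (@bop_cspan _ _ _ T e); last by have [_ _ ->] := be.
by move=> x ex; apply: sub_cspan; exists x.
Qed.

End dimension.

(** * Contractive completions with an isometric column *)

Section completion.
Variables (R : realType) (H1 H2 K1 K2 : hilbertType R).

Lemma hsum_innerE (H K : hilbertType R) (p q : hsum H K) :
  inner p q = inner p.1 q.1 + inner p.2 q.2.
Proof. by []. Qed.

(** Test the bound at [b = t e] with e = W^H V a. Since [W] is isometric the terms in t^2 cancel,
    and 2 t |e|^2 <= |a|^2 is left; the chosen [t] violates this unless [e] is 0. *)
Lemma contraction_orth (H K L : hilbertType R) (V : 'L(H, L)) (W : 'L(K, L)) :
  isometric W ->
  (forall a b, inner (V a + W b) (V a + W b) <= inner a a + inner b b) ->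
  forall a b, inner (V a) (W b) = 0.
Proof.
move=> Wi VW a b; pose e := W^H (V a).
suff e0 : e = 0 by rewrite inner_conj adjointP -/e e0 inner0r rmorph0.
apply: inner_eq0; apply/eqP/negPn/negP => ee0.
have egt0 : 0 < inner e e by rewrite lt_def ee0 inner_ge0.
pose t := (inner a a + 1) / inner e e.
have t0 : t^* = t.
  by apply/CrealP; rewrite realM ?realV ?realD ?real1 ?ger0_real ?inner_ge0.
have := VW a (t *: e); rewrite bopZ !innerDl !innerDr !innerZl !innerZr t0.
rewrite (isometric_inner _ _ Wi) [inner (W e) (V a)]adjointP.
rewrite [inner (V a) (W e)]adjointPr -/e.
have -> : inner (V a) (V a) + t * inner e e
    + (t * inner e e + t * (t * inner e e))
  = inner (V a) (V a) + (t * inner e e) *+ 2 + t * (t * inner e e) by ring.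
rewrite lerD2r lt_geF// /t divfK//.
rewrite ltr_wpDl ?inner_ge0// mulr2n ltr_pwDr ?lerDl//.
by rewrite ltr_wpDl ?inner_ge0.
Qed.

Lemma defect_positive (H K : hilbertType R) (T : 'L(H, K)) : contractive T ->
  positive_op (bop_id - T^H \oc T) /\ le_op (bop_id - T^H \oc T) bop_id.
Proof.
move=> Tc; split=> x; last first.
  rewrite bop_addE bop_oppE bop_addE opprD addrA subrr add0r bop_oppE opprK.
  by rewrite norm_adjoint_comp inner_ge0.
rewrite bop_addE bop_oppE innerDl innerNl norm_adjoint_comp subr_ge0.
by rewrite -norm_le_inner.
Qed.

Lemma defectP (H K : hilbertType R) (T : 'L(H, K)) : contractive T ->
  positive_op (bop_sqrt (bop_id - T^H \oc T)) /\
  bop_sqrt (bop_id - T^H \oc T) \oc bop_sqrt (bop_id - T^H \oc T)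
    = bop_id - T^H \oc T.
Proof. by move=> /defect_positive[T0 T1]; exact: bop_sqrtP. Qed.

Lemma cran_sub (H K : hilbertType R) (T : 'L(H, K)) (D : csubspace K) :
  (forall h, cs_set D (T h)) -> cs_set (cran T) `<=` cs_set D.
Proof.
move=> TD; have <- : closure (cs_set D) = cs_set D.
  exact/esym/closure_id/cs_closed.
by apply: closure_subset => _ [h _ <-].
Qed.

Lemma block_adjoint (A : 'L(H1, K1)) (B : 'L(H2, K1)) (C : 'L(H1, K2))
    (D : 'L(H2, K2)) : (block_op A B C D)^H = block_op A^H C^H B^H D^H.
Proof.
apply: adjoint_unique => -[g q] [y v].
rewrite -[LHS]/(inner (A g + B q) y + inner (C g + D q) v).
rewrite -[RHS]/(inner g (A^H y + C^H v) + inner q (B^H y + D^H v)).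
by rewrite !innerDl !innerDr -!adjointP addrACA.
Qed.

Variables (T11 : 'L(H1, K1)) (T12 : 'L(H2, K1)) (T22 : 'L(H2, K2)).
Hypothesis column_isometric : forall q,
  inner (T12 q) (T12 q) + inner (T22 q) (T22 q) = inner q q.
Hypothesis row_contractive : forall x,
  inner (T11^H x) (T11^H x) + inner (T12^H x) (T12^H x) <= inner x x.

Let d1 := bop_sqrt (bop_id - T12 \oc T12^H).
Let d2 := bop_sqrt (bop_id - T12^H \oc T12).

Variables (G1 : 'L(cran d1, H1)) (G2 : 'L(cran d2, K2)) (N : csubspace K2).
Hypothesis G1P : G1 \oc corestr d1 = T11^H.
Hypothesis G2P : G2 \oc corestr d2 = T22.
Hypothesis NP : forall u, cs_set N u <-> T22^H u = 0.

Let d3 := bop_sqrt (bop_id - G1 \oc G1^H).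

Let T12_contractive : contractive T12.
Proof.
by move=> q; rewrite norm_le_inner -(column_isometric q) lerDl inner_ge0.
Qed.

Let d1P : positive_op d1 /\ d1 \oc d1 = bop_id - T12 \oc T12^H.
Proof.
have := defectP (contractive_adjoint T12_contractive).
by rewrite adjointK.
Qed.

Let d2P : positive_op d2 /\ d2 \oc d2 = bop_id - T12^H \oc T12.
Proof. exact: defectP. Qed.

Let d1A : d1^H = d1. Proof. exact/positive_adjoint/d1P.1. Qed.
Let d2A : d2^H = d2. Proof. exact/positive_adjoint/d2P.1. Qed.

Let d1_norm k : inner (d1 k) (d1 k) = inner k k - inner (T12^H k) (T12^H k).
Proof.
rewrite -norm_adjoint_comp d1A d1P.2 bop_addE bop_oppE innerDl innerNl.
by rewrite -[X in X \oc _]adjointK norm_adjoint_comp.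
Qed.

Let d2_norm k : inner (d2 k) (d2 k) = inner k k - inner (T12 k) (T12 k).
Proof.
rewrite -norm_adjoint_comp d2A d2P.2 bop_addE bop_oppE innerDl innerNl.
by rewrite norm_adjoint_comp.
Qed.

Let intertwine : d2 \oc T12^H = T12^H \oc d1.
Proof.
apply: sqrt_intertwine; [exact: d2P.1|exact: d1P.1|].
rewrite d1P.2 d2P.2 bop_compDl bop_compDr bop_compNl bop_compNr.
by rewrite bop_comp1l bop_comp1r bop_compA.
Qed.

Let intertwineV : T12 \oc d2 = d1 \oc T12.
Proof.
have := congr1 (@adjoint _ _ _) intertwine.
by rewrite !adjoint_comp adjointK d1A d2A.
Qed.

(** The isometric column says |d2 q| = |T22 q|, and the range of [d2] is dense in the domain of
    [G2]. *)
Let G2_isometric : isometric G2.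
Proof.
apply/isometric_corestr => q; rewrite -bop_compE G2P.
by apply/norm_eq_inner; rewrite d2_norm -(column_isometric q) addrAC subrr add0r.
Qed.

Let G1_contractive : contractive G1.
Proof.
apply/contractive_corestr => x; rewrite -bop_compE G1P norm_le_inner d1_norm.
by rewrite lerBrDr.
Qed.

Let d3P : positive_op d3 /\ d3 \oc d3 = bop_id - G1 \oc G1^H.
Proof.
have := defectP (contractive_adjoint G1_contractive).
by rewrite adjointK.
Qed.

Let d3A : d3^H = d3. Proof. exact/positive_adjoint/d3P.1. Qed.

Let d3_norm g : inner (d3 g) (d3 g) = inner g g - inner (G1^H g) (G1^H g).
Proof.
rewrite -norm_adjoint_comp d3A d3P.2 bop_addE bop_oppE innerDl innerNl.
by rewrite -[X in X \oc _]adjointK norm_adjoint_comp.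
Qed.

Let T11E g : T11 g = d1 (val (G1^H g)).
Proof.
rewrite -[T11]adjointK -G1P adjoint_comp corestr_adjoint.
by rewrite d1A.
Qed.

Let T22AE u : T22^H u = d2 (val (G2^H u)).
Proof. by rewrite -G2P adjoint_comp corestr_adjoint d2A. Qed.

Let T12A_cran k : cs_set (cran d1) k -> cs_set (cran d2) (T12^H k).
Proof.
apply: (@cran_sub _ _ d1 (bop_preim T12^H (cran d2))) => x.
suff : cs_set (cran d2) ((T12^H \oc d1) x) by [].
by rewrite -intertwine; apply: subset_closure; exists (T12^H x).
Qed.

Let T12_cran q : cs_set (cran d2) q -> cs_set (cran d1) (T12 q).
Proof.
apply: (@cran_sub _ _ d2 (bop_preim T12 (cran d1))) => x.
suff : cs_set (cran d1) ((T12 \oc d2) x) by [].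
by rewrite intertwineV; apply: subset_closure; exists (T12 x).
Qed.

(** T22^H = d2 G2^H, and [d2] is injective on the closure of its own range. *)
Let NG2 u : cs_set N u <-> G2^H u = 0.
Proof.
split=> [/NP|G2u]; last by apply/NP; rewrite T22AE G2u bop0.
rewrite T22AE => T22u; apply: (@corestr_adjoint_inj _ _ _ d2).
by rewrite corestr_adjoint d2A.
Qed.

(** The entry that belongs to [Q = 0]. It takes values in the range of [G2], which is orthogonal to
    [N]. *)
Let X0 := - (G2 \oc bop_proj (cran d2) \oc T12^H \oc cs_incl (cran d1) \oc G1^H).

Definition completion_entry (Q : 'L(cran d3, N)) : 'L(H1, K2) :=
  X0 + cs_incl N \oc Q \oc corestr d3.

Let X0E g : X0 g = - G2 (bop_proj (cran d2) (T12^H (val (G1^H g)))).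
Proof. by []. Qed.

Let X0_orth g n : cs_set N n -> inner (X0 g) n = 0.
Proof. by move=> /NG2 G2n; rewrite X0E innerNl adjointP G2n inner0r oppr0. Qed.

(** With k = G1^H g, the two terms are |d1 k|^2 = |k|^2 - |T12^H k|^2 and |G2 T12^H k|^2 = |T12^H
    k|^2. *)
Let X0_norm g : inner (T11 g) (T11 g) + inner (X0 g) (X0 g)
  = inner (G1^H g) (G1^H g).
Proof.
rewrite X0E innerNl innerNr opprK (isometric_inner _ _ G2_isometric) cs_innerE.
rewrite bop_proj_val; last exact/T12A_cran/cs_mem.
by rewrite T11E d1_norm subrK.
Qed.

(** With k = G1^H g, the first summand is T12^H d1 k and the second is - d2 T12^H k, since G2^H G2 =
    1; they cancel by [intertwine]. *)
Let X0_cross : T12^H \oc T11 + T22^H \oc X0 = 0.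
Proof.
apply: bopP_eq => g; rewrite bop_addE !bop_compE X0E bopN T22AE.
have -> w : G2^H (G2 w) = w.
  exact: (congr1 (fun F : 'L(cran d2, cran d2) => F w) ((isometricP _).1 G2_isometric)).
rewrite bop_proj_val; last exact/T12A_cran/cs_mem.
rewrite T11E -[T12^H (d1 _)]/((T12^H \oc d1) _) -intertwine; exact: subrr.
Qed.

Section with_entry.
Variable X : 'L(H1, K2).
Let V := block_op T11 T12 X T22.
Let E := T12^H \oc T11 + T22^H \oc X.

Let W1 := pair_op T11 X.
Let W2 := pair_op T12 T22.

Let W2_isometric : isometric W2.
Proof. by move=> q; apply/norm_eq_inner; rewrite -column_isometric. Qed.

Let VE g q : V (g, q) = W1 g + W2 q. Proof. by []. Qed.

Let cross g q : inner (W1 g) (W2 q) = inner (E g) q.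
Proof.
rewrite -[LHS]/(inner (T11 g) (T12 q) + inner (X g) (T22 q)).
by rewrite !adjointPr -innerDl.
Qed.

Let V_norm p : E = 0 -> inner (V p) (V p)
  = inner (T11 p.1) (T11 p.1) + inner (X p.1) (X p.1) + inner p.2 p.2.
Proof.
case: p => g q E0; rewrite VE innerDl !innerDr (inner_conj (W1 g) (W2 q)) cross E0.
by rewrite inner0l rmorph0 addr0 add0r (isometric_inner _ _ W2_isometric).
Qed.

Let contractive_cross : contractive V -> E = 0.
Proof.
move=> Vc; apply: bopP_eq => g; apply: inner_inj => q; rewrite -cross inner0l.
apply: contraction_orth => // a b; have := Vc (a, b).
by rewrite norm_le_inner VE.
Qed.

(** [X] and [X0] solve the same linear equation, so T22^H kills their difference, which therefore
    takes values in [N]. *)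
Let entry_form : E = 0 ->
  exists X' : 'L(H1, N), X = X0 + cs_incl N \oc X'.
Proof.
move=> E0; exists (bop_proj N \oc (X - X0)); apply: bopP_eq => g.
rewrite bop_addE bop_compE cs_inclE bop_compE bop_proj_val.
  by rewrite bop_addE bop_oppE addrC subrK.
apply/NP; rewrite bop_addE bop_oppE bopD bopN; apply/eqP; rewrite subr_eq0.
rewrite -(inj_eq (addrI (T12^H (T11 g)))).
have /(congr1 (fun F : 'L(H1, H2) => F g)) E0g := E0.
have /(congr1 (fun F : 'L(H1, H2) => F g)) X0g := X0_cross.
by apply/eqP; exact: etrans E0g (esym X0g).
Qed.

Let entry_cross (X' : 'L(H1, N)) : X = X0 + cs_incl N \oc X' -> E = 0.
Proof.
move=> XE; rewrite /E XE bop_compDr addrA X0_cross add0r; apply: bopP_eq => g.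
exact/NP/cs_mem.
Qed.

Let entry_norm (X' : 'L(H1, N)) : X = X0 + cs_incl N \oc X' ->
  forall p, inner (V p) (V p)
    = inner p p - inner (d3 p.1) (d3 p.1) + inner (X' p.1) (X' p.1).
Proof.
move=> XE p; rewrite V_norm; last exact: entry_cross XE.
have -> : inner (X p.1) (X p.1)
    = inner (X0 p.1) (X0 p.1) + inner (X' p.1) (X' p.1).
  rewrite XE bop_addE bop_compE cs_inclE innerDl !innerDr.
  have Nx : cs_set N (val (X' p.1)) by exact: cs_mem.
  by rewrite (inner_conj (X0 _) (val _)) !(X0_orth _ Nx) rmorph0 addr0 add0r.
rewrite addrA X0_norm d3_norm -[inner p p]/(inner p.1 p.1 + inner p.2 p.2).
by ring.
Qed.

Lemma contractive_completionP :
  contractive V <-> exists2 Q : 'L(cran d3, N), contractive Q & X = completion_entry Q.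
Proof.
split=> [Vc|[Q /contractive_corestr Qc]].
  have [X' XE] := entry_form (contractive_cross Vc).
  have [g|Q Qc QX'] := @factor_corestr _ _ _ _ d3 X'.
    rewrite norm_le_inner; have := Vc (g, 0); rewrite norm_le_inner (entry_norm XE).
    by rewrite -addrA gerDl addrC subr_le0.
  by exists Q => //; rewrite XE -QX' /completion_entry bop_compA.
rewrite /completion_entry -bop_compA => XE p.
rewrite norm_le_inner (entry_norm XE) -addrA gerDl addrC subr_le0.
by rewrite -norm_le_inner Qc.
Qed.

Lemma isometric_completionP :
  isometric V <-> exists2 Q : 'L(cran d3, N), isometric Q & X = completion_entry Q.
Proof.
split=> [Vi|[Q /isometric_corestr Qi]].
  have Vc : contractive V by move=> p; rewrite Vi.
  have [X' XE] := entry_form (contractive_cross Vc).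
  have X'd g : inner (X' g) (X' g) = inner (d3 g) (d3 g).
    have /norm_eq_inner := Vi (g, 0); rewrite (entry_norm XE) -addrA => /eqP.
    by rewrite -subr_eq0 addrAC subrr add0r addrC subr_eq0 => /eqP.
  have [g|Q Qc QX'] := @factor_corestr _ _ _ _ d3 X'.
    by rewrite norm_le_inner X'd.
  exists Q; last by rewrite XE -QX' /completion_entry bop_compA.
  by apply/isometric_corestr => g; rewrite -bop_compE QX'; apply/norm_eq_inner.
rewrite /completion_entry -bop_compA => XE p.
apply/norm_eq_inner; rewrite (entry_norm XE) bop_compE.
by have /norm_eq_inner -> := Qi p.1; rewrite subrK.
Qed.

End with_entry.

Section isometric_row.
Hypothesis row_isometric : forall x,
  inner (T11^H x) (T11^H x) + inner (T12^H x) (T12^H x) = inner x x.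

Let G1_isometric : isometric G1.
Proof.
apply/isometric_corestr => x; rewrite -bop_compE G1P; apply/norm_eq_inner.
by rewrite d1_norm -(row_isometric x) addrK.
Qed.

(** Now G1^H G1 = 1, so d3^2 is a projection and |d3 (d3 v)| = |d3 v|; by [d3_norm] at [d3 v]
    nothing is left for G1^H (d3 v). *)
Let G1A_cran g : cs_set (cran d3) g -> G1^H g = 0.
Proof.
apply: (@cran_sub _ _ d3 (bop_ker G1^H)) => v; apply: inner_eq0.
have d3d3 w : d3 (d3 w) = w - G1 (G1^H w).
  exact: (congr1 (fun F : 'L(H1, H1) => F w) d3P.2).
have := d3_norm (d3 v); rewrite d3d3 d3_norm !innerDl !innerDr !innerNl !innerNr.
rewrite (isometric_inner _ _ G1_isometric) [inner (G1 _) v]adjointP.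
rewrite [inner v (G1 _)]adjointPr opprK addNr addr0.
by rewrite -[X in X = _]addr0 => /addrI/esym/eqP; rewrite oppr_eq0 => /eqP.
Qed.

(** T11 = d1 G1^H has the kernel of G1^H because [d1] is injective on its closed range, and on that
    kernel d3^2 is the identity, so that [d3 g] is a preimage of [g]. *)
Lemma cran_defect3 g : cs_set (cran d3) g <-> T11 g = 0.
Proof.
split=> [/G1A_cran G1g|]; first by rewrite T11E G1g bop0.
rewrite -[T11]adjointK -G1P adjoint_comp => /(@corestr_adjoint_inj _ _ _ d1) G1g.
apply: subset_closure; exists (d3 g) => //.
have -> : d3 (d3 g) = g - G1 (G1^H g).
  exact: (congr1 (fun F : 'L(H1, H1) => F g) d3P.2).
by rewrite G1g bop0 subr0.
Qed.

Let entry_adjoint (Q : 'L(cran d3, N)) u : (completion_entry Q)^H u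
  = - G1 (bop_proj (cran d1) (T12 (val (G2^H u)))) + d3 (val (Q^H (bop_proj N u))).
Proof.
rewrite /completion_entry adjointD bop_addE; congr (_ + _).
  rewrite /X0 adjointN bop_oppE !adjoint_comp !adjointK; congr (- _).
by rewrite !adjoint_comp !bop_compE corestr_adjoint d3A.
Qed.

(** The two parts of the adjoint entry are orthogonal, as G1^H d3 = 0, and [G1] and [d3] preserve
    their norms. The first contributes |T12 k|^2 with k = G2^H u, which completes |T22^H u|^2 = |d2
    k|^2 to |k|^2. *)
Let entry_adjoint_norm (Q : 'L(cran d3, N)) u :
  inner ((completion_entry Q)^H u) ((completion_entry Q)^H u)
    + inner (T22^H u) (T22^H u)
  = inner (G2^H u) (G2^H u) + inner (Q^H (bop_proj N u)) (Q^H (bop_proj N u)).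
Proof.
rewrite entry_adjoint; set w := Q^H _; set k := G2^H u.
have G1w : G1^H (d3 (val w)) = 0.
  by apply: G1A_cran; apply: subset_closure; exists (val w).
rewrite !innerDl !innerDr !innerNl !innerNr opprK.
rewrite (isometric_inner _ _ G1_isometric) [inner (G1 _) _]adjointP.
rewrite [inner _ (G1 _)]adjointPr G1w inner0l inner0r oppr0 addr0 add0r.
rewrite cs_innerE bop_proj_val; last exact/T12_cran/cs_mem.
rewrite d3_norm G1A_cran; last exact: cs_mem.
rewrite inner0l subr0 T22AE d2_norm -!cs_innerE.
by rewrite addrAC addrCA subrr addr0.
Qed.

(** [N] is the kernel of G2^H, that is, the orthogonal complement of the range of the isometry
    [G2]. *)
Let norm_split u : inner u u
  = inner (G2^H u) (G2^H u) + inner (bop_proj N u) (bop_proj N u).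
Proof.
pose n := u - G2 (G2^H u).
have Nn : cs_set N n.
  apply/NG2; rewrite bopD bopN.
  have -> w : G2^H (G2 w) = w.
    exact: (congr1 (fun F : 'L(cran d2, cran d2) => F w) ((isometricP _).1 G2_isometric)).
  exact: subrr.
have orthG w m : cs_set N m -> inner (G2 w) m = 0.
  by move=> /NG2 G2m; rewrite adjointP G2m inner0r.
have uE : u = G2 (G2^H u) + n by rewrite addrC subrK.
have PG w : bop_proj N (G2 w) = 0.
  by apply: bop_proj_orth0 => y; exact: orthG.
have -> : bop_proj N u = bop_proj N n by rewrite {1}uE bopD PG add0r.
clearbody n.
rewrite [X in _ + X]cs_innerE bop_proj_val// {1 2}uE !innerDl !innerDr.
rewrite (isometric_inner _ _ G2_isometric) (inner_conj (G2 _) n) orthG// rmorph0.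
by rewrite addr0 add0r.
Qed.

(** [V] is isometric, so [V^H] is a contraction, and its column on [K1] is isometric by the row
    hypothesis; [contraction_orth] now applies to [V^H]. Only the column on [K2] is left, and
    [entry_adjoint_norm] and [norm_split] differ exactly by Q^H on [N]. *)
Lemma coisometric_completionP (Q : 'L(cran d3, N)) : isometric Q ->
  coisometric (block_op T11 T12 (completion_entry Q) T22) <-> coisometric Q.
Proof.
move=> Qi; set X := completion_entry Q; set V := block_op _ _ _ _.
have VA x u : V^H (x, u) = pair_op T11^H T12^H x + pair_op X^H T22^H u.
  by rewrite /V block_adjoint.
have Vi : isometric V by apply/isometric_completionP; exists Q.
have VAc : contractive V^H by apply: contractive_adjoint => p; rewrite Vi.
have Wi : isometric (pair_op T11^H T12^H).
  by move=> x; apply/norm_eq_inner; rewrite -[RHS]row_isometric.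
have orthW u x : inner (pair_op X^H T22^H u) (pair_op T11^H T12^H x) = 0.
  apply: contraction_orth => // a b; rewrite addrC -VA [leRHS]addrC.
  by have := VAc (b, a); rewrite norm_le_inner.
have VAn x u : inner (V^H (x, u)) (V^H (x, u)) = inner x x
    + (inner (G2^H u) (G2^H u) + inner (Q^H (bop_proj N u)) (Q^H (bop_proj N u))).
  rewrite VA innerDl !innerDr (inner_conj (pair_op X^H T22^H u)) orthW rmorph0.
  by rewrite addr0 add0r (isometric_inner _ _ Wi) -entry_adjoint_norm.
split=> [Vco n|Qco [x u]].
  have /norm_eq_inner := Vco (0, val n); rewrite VAn.
  rewrite [X in _ = X -> _]hsum_innerE /= !inner0l.
  have -> : bop_proj N (val n) = n by apply: val_inj; rewrite bop_proj_val//; exact: cs_mem.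
  have /NG2 -> := cs_mem n; rewrite inner0l !add0r => nn.
  exact/norm_eq_inner.
apply/norm_eq_inner; rewrite VAn.
by have /norm_eq_inner -> := Qco (bop_proj N u); rewrite -norm_split.
Qed.

End isometric_row.

End completion.

(** * Orthogonal splittings and unitary changes of variables *)

Section unitary_operators.
Variable R : realType.
Implicit Types H K L : hilbertType R.

Lemma row_adjoint H K L (S : 'L(H, L)) (T : 'L(K, L)) :
  (row_op S T)^H = pair_op S^H T^H.
Proof.
by apply: adjoint_unique => -[x y] z; rewrite innerDl !adjointP.
Qed.

Lemma gram_defect_form H K L (T : 'L(H, K)) (S : 'L(H, L)) p r :
  inner ((T^H \oc T + S^H \oc S - bop_id) p) r
    = inner (T p) (T r) + inner (S p) (S r) - inner p r.
Proof. by rewrite bop_addE bop_oppE bop_addE !innerDl innerNl -!adjointPr. Qed.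

(** Operators such as [CV] take arguments in the type of the subspace, so their comparison needs the
    generators to be total inside that type. *)
Lemma cspan_lift H (G : set H) :
  cs_set (cspan [set p : cspan G | G (val p)]) = setT.
Proof.
apply: orth_eq0 => p pG; apply: inner_eq0; rewrite cs_innerE.
suff : cs_set (orth [set val p]) (val p) by exact.
apply: (@cspan_sub _ _ G) (cs_mem p) => x Gx y ->.
have [q qx] := cs_lift (sub_cspan Gx); rewrite -qx -cs_innerE inner_conj.
by rewrite pG ?rmorph0//; apply: sub_cspan; rewrite /= qx.
Qed.

Lemma proj_orth_split H (D : csubspace H) x :
  val (bop_proj (orth (cs_set D)) x) + val (bop_proj D x) = x.
Proof.
have xE : x = (x - val (bop_proj D x)) + val (bop_proj D x) by rewrite subrK.
rewrite [X in bop_proj (orth _) X]xE bopD (bop_proj_orth0 (x := val _)) ?addr0.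
  by rewrite bop_proj_val ?subrK//; exact: bop_proj_orth.
by move=> y yD; rewrite inner_conj yD ?rmorph0//; exact: cs_mem.
Qed.

Lemma proj_orth_norm H (D : csubspace H) x :
  inner (bop_proj (orth (cs_set D)) x) (bop_proj (orth (cs_set D)) x)
    + inner (bop_proj D x) (bop_proj D x) = inner x x.
Proof.
rewrite -[in RHS](proj_orth_split D x) innerDl !innerDr !cs_innerE.
have Do : inner (val (bop_proj (orth (cs_set D)) x)) (val (bop_proj D x)) = 0.
  by apply: (cs_mem (bop_proj (orth (cs_set D)) x)); exact: cs_mem.
rewrite (inner_conj (val (bop_proj (orth _) x)) (val (bop_proj D x))) Do.
by rewrite rmorph0 addr0 add0r.
Qed.

Lemma proj_orth_incl H (D : csubspace H) :
  bop_proj D \oc cs_incl (orth (cs_set D)) = 0.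
Proof. by apply: bopP_eq => x; apply: bop_proj_orth0; exact: cs_mem. Qed.

Lemma isometric_surj_unitary H K (T : 'L(H, K)) :
  isometric T -> (forall y, exists x, T x = y) -> unitary T.
Proof.
move=> Ti Ts; split=> // y; have [x <-] := Ts y.
have /isometricP TT := Ti; rewrite -bop_compE TT Ti//.
Qed.

Lemma contractive_comp_unitary H K L (M : 'L(K, L)) (W : 'L(H, K)) :
  unitary W -> contractive (M \oc W) <-> contractive M.
Proof.
move=> [Wi Wc]; split=> Mc x; last by rewrite bop_compE -(Wi x).
have /unitaryP[_ WW] : unitary W by [].
have := Mc (W^H x); rewrite bop_compE -[W (W^H x)]/((W \oc W^H) x) WW.
by rewrite Wc.
Qed.

Lemma isometric_comp_unitary H K L (M : 'L(K, L)) (W : 'L(H, K)) :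
  unitary W -> isometric (M \oc W) <-> isometric M.
Proof.
move=> [Wi Wc]; split=> Mi x; last by rewrite bop_compE Mi.
have /unitaryP[_ WW] : unitary W by [].
have := Mi (W^H x); rewrite bop_compE -[W (W^H x)]/((W \oc W^H) x) WW.
by rewrite Wc.
Qed.

Lemma coisometric_comp_unitary H K L (M : 'L(K, L)) (W : 'L(H, K)) :
  unitary W -> coisometric (M \oc W) <-> coisometric M.
Proof.
by move=> [_ Wc]; rewrite /coisometric adjoint_comp; split=> Mc x;
  have := Mc x; rewrite bop_compE Wc.
Qed.

Lemma bop_inv_unique H K (T : 'L(H, K)) (T' : 'L(K, H)) :
  T' \oc T = bop_id -> T \oc T' = bop_id -> bop_inv T = T'.
Proof.
move=> T'T TT'; rewrite /bop_inv; case: xgetP => [V _ [VT TV]|]; last first.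
  by move=> /(_ T')[].
by rewrite -[V]bop_comp1r -TT' bop_compA VT bop_comp1l.
Qed.

(** [E] and [F] consist of the same vectors, but [E] is a subspace of the type of [D]; the unitary
    translates dimensions between the two. *)
Lemma nested_csubspace_unitary H (D : csubspace H) (E : csubspace D) (F : csubspace H) :
  (forall x, cs_set F x -> cs_set D x) ->
  (forall x : D, cs_set E x <-> cs_set F (val x)) ->
  exists J : 'L(F, E), unitary J.
Proof.
move=> FD EF; pose J := bop_proj E \oc bop_proj D \oc cs_incl F.
have Jval (x : F) : val (val (J x)) = val x.
  have Dx : val (bop_proj D (val x)) = val x by apply/bop_proj_val/FD/cs_mem.
  by rewrite bop_proj_val//; apply/EF; rewrite Dx; exact: cs_mem.
exists J; apply: isometric_surj_unitary => [x|y].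
  by rewrite !cs_norm Jval.
have [x xy] := cs_lift ((EF _).1 (cs_mem y)).
by exists x; apply/val_inj/val_inj; rewrite Jval.
Qed.

End unitary_operators.

(** * Colligations *)

Section unit_ball_theory.
Variables (R : realType) (d : nat).
Implicit Types l z : 'rV[R[i]]_d.

Lemma cdot_ge0 l : 0 <= cdot l l.
Proof. by apply: sumr_ge0 => j _; rewrite mul_conjC_ge0. Qed.

Lemma cdot_CauchySchwarz l z : `|cdot l z| ^+ 2 <= cdot l l * cdot z z.
Proof.
apply: (@ip_CauchySchwarz R 'rV[R[i]]_d (@cdot R d)) => [a x y w|x y|x|x].
- rewrite /cdot mulr_sumr -big_split; apply: eq_bigr => j _ /=.
  by rewrite !mxE mulrDl mulrA.
- rewrite /cdot rmorph_sum; apply: eq_bigr => j _ /=.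
  by rewrite rmorphM /= conjCK mulrC.
- exact: cdot_ge0.
move=> /eqP; rewrite psumr_eq0 => [/allP x0|j _]; last by rewrite mul_conjC_ge0.
apply/rowP => j; rewrite mxE; apply/eqP; rewrite -mul_conjC_eq0.
by apply: x0; rewrite mem_index_enum.
Qed.

Lemma unit_ball0 : unit_ball (0 : 'rV[R[i]]_d).
Proof.
rewrite /unit_ball /= /cdot big1 ?ltr01// => j _.
by rewrite !mxE mul0r.
Qed.

Lemma unit_ball_cdot l z : unit_ball l -> unit_ball z -> 1 - cdot l z != 0.
Proof.
move=> l1 z1; rewrite subr_eq0; apply/eqP => lz.
have := cdot_CauchySchwarz l z; rewrite -lz normr1 expr1n lt_geF//.
by apply: le_lt_trans l1; rewrite ler_piMr ?cdot_ge0// ltW.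
Qed.

End unit_ball_theory.

Section colligation_theory.
Variables (R : realType) (d : nat) (U Y X : hilbertType R).
Implicit Types l z : 'rV[R[i]]_d.

Lemma Zop_adjoint l :
  (Zop X l)^H = col_op (fun j => (l 0 j)^* *: bop_id).
Proof.
apply: adjoint_unique => p x; rewrite inner_suml; apply: eq_bigr => j _.
by rewrite ffunE bop_scaleE innerZl innerZr conjCK.
Qed.

(** This scalar is what the denominator of the kernel is made of. *)
Lemma Zop_Zop_adjoint l z x : Zop X l ((Zop X z)^H x) = cdot l z *: x.
Proof.
rewrite Zop_adjoint /= /cdot scaler_suml; apply: eq_bigr => j _.
by rewrite ffunE; exact: scalerA.
Qed.

Lemma Zop_norm l p : `|Zop X l p| ^+ 2 <= cdot l l * `|p| ^+ 2.
Proof.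
have [->|Zp0] := eqVneq (Zop X l p) 0.
  by rewrite normr0 expr0n mulr_ge0 ?cdot_ge0// exprn_ge0.
have Z0 : 0 < `|Zop X l p| ^+ 2 by rewrite exprn_gt0// normr_gt0.
have e1 : inner (Zop X l p) (Zop X l p) = inner p ((Zop X l)^H (Zop X l p)).
  by rewrite adjointP.
have := inner_CauchySchwarz p ((Zop X l)^H (Zop X l p)).
have e2 : `|(Zop X l)^H (Zop X l p)| ^+ 2 = cdot l l * `|Zop X l p| ^+ 2.
  by rewrite -!inner_norm -adjointP Zop_Zop_adjoint innerZl.
rewrite -e1 inner_norm ger0_norm; last exact: ltW.
rewrite -(ler_pXn2r (n := 2)) ?nnegrE ?mulr_ge0 ?(ltW Z0)//.
rewrite [(_ * `|_ (Zop X l p)|) ^+ 2]exprMn e2 [X in X <= _ -> _]expr2.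
rewrite [X in _ <= X -> _]mulrA.
by rewrite ler_pM2r// mulrC.
Qed.

Variables (A : 'I_d -> 'L(X, X)) (C : 'L(X, Y)).

Lemma gram_form x : inner (gram A C x) x
  = inner (col_op A x) (col_op A x) + inner (C x) (C x).
Proof.
rewrite /gram bop_addE innerDl norm_adjoint_comp bop_sumE inner_suml.
congr (_ + _); apply: eq_bigr => j _.
by rewrite norm_adjoint_comp !ffunE.
Qed.

Lemma isometric_pairP : isometric_pair C A <-> forall x,
  inner (col_op A x) (col_op A x) + inner (C x) (C x) = inner x x.
Proof.
split=> [gi x|gi]; first by rewrite -gram_form gi.
apply/eqP; rewrite -subr_eq0; apply/eqP/bop_eq0_form => x.
by rewrite bop_addE bop_oppE innerDl innerNl gram_form gi subrr.
Qed.

Lemma row_norm x :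
  inner ((T11 C A)^H x) ((T11 C A)^H x) + inner ((T12 C A)^H x) ((T12 C A)^H x)
    = inner (col_op A x) (col_op A x) + inner (C x) (C x).
Proof.
rewrite /T11 /T12 row_adjoint !adjoint_comp !adjointK hsum_innerE /= addrA.
by rewrite proj_orth_norm.
Qed.

Hypothesis CA_contractive : contractive_pair C A.

Lemma contractive_pairP x :
  inner (col_op A x) (col_op A x) + inner (C x) (C x) <= inner x x.
Proof.
rewrite -gram_form -subr_ge0.
by have := CA_contractive x; rewrite bop_addE bop_oppE innerDl innerNl.
Qed.

Let resolvent z := bop_inv (bop_id - Zop X z \oc col_op A).

Let resolventP z : unit_ball z ->
  resolvent z \oc (bop_id - Zop X z \oc col_op A) = bop_id /\
  (bop_id - Zop X z \oc col_op A) \oc resolvent z = bop_id.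
Proof.
move=> z1; have zr : (complex.Re (cdot z z))%:C%C = cdot z z.
  by rewrite RRe_real// ger0_real// cdot_ge0.
(* Here q = |z| < 1: |Z(z) A x| <= |z| |A x| <= |z| |x|, since a contractive pair has a contractive
   column [A]. *)
apply: (@bop_inv_id_sub _ _ _ (Num.sqrt (complex.Re (cdot z z)))).
  rewrite -[ltRHS]sqrtr1 ltr_sqrt// -ltcR zr; exact: z1.
move=> x; rewrite -(ler_pXn2r (n := 2)) ?nnegrE ?mulr_ge0 ?ler0c ?sqrtr_ge0//.
rewrite exprMn -rmorphXn sqr_sqrtr; last by rewrite -ler0c zr cdot_ge0.
rewrite -[X in _ <= X * _]/((complex.Re (cdot z z))%:C%C) zr.
rewrite (le_trans (Zop_norm _ _))// ler_wpM2l ?cdot_ge0//.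
rewrite -!inner_norm (le_trans _ (contractive_pairP x))// lerDl.
exact: inner_ge0.
Qed.

Let resolvent_adjoint z : unit_ball z ->
  bop_inv (bop_id - (col_op A)^H \oc (Zop X z)^H) = (resolvent z)^H.
Proof.
move=> /resolventP[RT TR].
have TA : (bop_id - Zop X z \oc col_op A)^H = bop_id - (col_op A)^H \oc (Zop X z)^H.
  by rewrite adjointB adjoint_id adjoint_comp.
by apply: bop_inv_unique; rewrite -TA -adjoint_comp ?RT ?TR adjoint_id.
Qed.

Let ZAE z : \sum_j z 0 j *: A j = Zop X z \oc col_op A.
Proof.
apply: bopP_eq => x; rewrite bop_sumE /=; apply: eq_bigr => j _.
by rewrite ffunE.
Qed.

Let kernel_CAE l z : unit_ball z ->
  kernel_CA C A l z = C \oc resolvent l \oc (resolvent z)^H \oc C^H.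
Proof.
move=> z1; rewrite /kernel_CA ZAE.
have -> : \sum_j (z 0 j)^* *: (A j)^H = (col_op A)^H \oc (Zop X z)^H.
  rewrite -adjoint_comp -ZAE adjoint_sum; apply: eq_bigr => j _.
  by rewrite adjointZ.
by rewrite resolvent_adjoint.
Qed.

(** The generator of [space_D], with the resolvent of the adjoint rewritten as the adjoint of the
    resolvent. *)
Let gen z y := (Zop X z)^H ((resolvent z)^H (C^H y)).

Let genE z y : unit_ball z -> ((Zop X z)^H
  \oc bop_inv (bop_id - (col_op A)^H \oc (Zop X z)^H) \oc C^H) y = gen z y.
Proof. by move=> z1; rewrite resolvent_adjoint. Qed.

Let gen_D z y : unit_ball z -> cs_set (space_D C A) (gen z y).
Proof. by move=> z1; apply: sub_cspan; exists z, y; rewrite genE. Qed.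

(** The resolvent identity R = 1 + T R, for T = A^H Z(z)^H; it evaluates [T12] on a generator paired
    with its vector. *)
Let gen_state z y : unit_ball z ->
  (col_op A)^H (gen z y) + C^H y = (resolvent z)^H (C^H y).
Proof.
move=> /resolventP[RT _]; have := congr1 (@adjoint _ _ _) RT.
rewrite adjoint_comp adjointB !adjoint_id adjoint_comp => TR.
have vE : (resolvent z)^H (C^H y) - (col_op A)^H (gen z y) = C^H y.
  exact: (congr1 (fun F : 'L(X, X) => F (C^H y)) TR).
by rewrite -[X in _ + X]vE addrC subrK.
Qed.

Variable S : 'rV[R[i]]_d -> 'L(U, Y).
Hypothesis kernelE : forall l z, unit_ball l -> unit_ball z ->
  kernel_S S l z = kernel_CA C A l z.
Variable CV : 'L(space_D C A, U).
Hypothesis CVP : is_CV S CV.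

Let kernel_form z w y y' : unit_ball z -> unit_ball w ->
  inner y y' - inner ((S z)^H y) ((S w)^H y') = (1 - cdot w z) *
    inner ((resolvent z)^H (C^H y)) ((resolvent w)^H (C^H y')).
Proof.
move=> z1 w1.
have /(congr1 (fun F : 'L(Y, Y) => inner (F y) y')) := kernelE w1 z1.
rewrite kernel_CAE// /kernel_S /da_kernel bop_scaleE innerZl bop_addE bop_oppE.
rewrite innerDl innerNl /= !adjointP => <-.
by rewrite mulrA divff ?mul1r ?unit_ball_cdot.
Qed.

Let gens := [set q : hsum (space_D C A) Y |
  exists2 z, unit_ball z & val q.1 = gen z q.2].

(** At z = 0 the generator is 0, so [gens] contains every [(0, y)]; what is orthogonal to these and
    to [gens] is orthogonal to all generators of D. *)
Let gens_dense : cs_set (cspan gens) = setT.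
Proof.
apply: orth_eq0 => -[p y] py; have pyg q : gens q -> inner p q.1 + inner y q.2 = 0.
  by move=> gq; apply: py; exact: sub_cspan.
have y0 : y = 0.
  apply: inner_eq0; have := pyg (0, y); rewrite /= inner0r add0r; apply.
  exists 0; first exact: unit_ball0.
  rewrite /= /gen Zop_adjoint; apply/ffunP => j.
  by rewrite !ffunE mxE bop_scaleE conjC0 scale0r.
suff -> : p = 0 by rewrite y0.
apply: inner_inj => q; rewrite inner0l.
have : cs_set (orth [set p]) q; last first.
  by move=> /(_ _ erefl) qp; rewrite inner_conj qp rmorph0.
have : cs_set (cspan [set q : space_D C A | exists z y, unit_ball z /\ val q = ((Zop X z)^H
  \oc bop_inv (bop_id - (col_op A)^H \oc (Zop X z)^H) \oc C^H) y]) q.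
  by rewrite cspan_lift.
apply: cspan_sub => {}q [z [y' [z1]]]; rewrite genE// => qE _ ->.
have pq : inner p q = 0.
  by have := pyg (q, y'); rewrite /= y0 inner0l addr0; apply; exists z.
by rewrite inner_conj pq rmorph0.
Qed.

Let T12_gens q z : unit_ball z -> val q.1 = gen z q.2 ->
  T12 C A q = (resolvent z)^H (C^H q.2).
Proof. by move=> z1 qE; rewrite -gen_state// -qE. Qed.

Let T22_gens q z : unit_ball z -> val q.1 = gen z q.2 ->
  T22 S CV q = (S z)^H q.2.
Proof.
move=> z1 qE; rewrite -[LHS]/(CV q.1 + (S 0)^H q.2) (CVP z1 (y := q.2)).
  by rewrite bop_addE bop_oppE subrK.
by rewrite genE.
Qed.

(** On [gens] the operators [T12] and [T22] give the state and S(z)^H y, and the inner product of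
    two generators is <w, z> times that of their states. The claim there is the kernel identity
    multiplied by 1 - <w, z>. *)
Lemma column_isometric q :
  inner (T12 C A q) (T12 C A q) + inner (T22 S CV q) (T22 S CV q) = inner q q.
Proof.
pose F := (T12 C A)^H \oc T12 C A + (T22 S CV)^H \oc T22 S CV - bop_id.
have FE p r : inner (F p) r = inner (T12 C A p) (T12 C A r)
    + inner (T22 S CV p) (T22 S CV r) - inner p r.
  exact: gram_defect_form.
apply/eqP; rewrite -subr_eq0 -FE; apply/eqP.
have qG : cs_set (cspan gens) q by rewrite gens_dense.
apply: (cspan_form0 _ qG qG) => p r [z z1 pE] [w w1 rE].
rewrite FE (T12_gens z1 pE) (T12_gens w1 rE) (T22_gens z1 pE) (T22_gens w1 rE).
rewrite hsum_innerE cs_innerE pE rE.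
have -> : inner (gen z p.2) (gen w r.2) = cdot w z *
    inner ((resolvent z)^H (C^H p.2)) ((resolvent w)^H (C^H r.2)).
  by rewrite /gen -[LHS]adjointP Zop_Zop_adjoint innerZl.
have := kernel_form p.2 r.2 z1 w1; set k := inner _ ((resolvent w)^H _).
by move=> /(canRL (subrK _)) ->; ring.
Qed.

(** On the total set [gens] the values of [T22] are the vectors S(z)^H y, so u is orthogonal to the
    range of [T22] exactly when every S(z) kills it. *)
Lemma null_inputsP u : cs_set (null_inputs S) u <-> (T22 S CV)^H u = 0.
Proof.
split=> [Su|T22u z z1].
  apply: inner_eq0; have : cs_set (cspan gens) ((T22 S CV)^H u) by rewrite gens_dense.
  move=> /(@cspan_sub _ _ gens (orth [set (T22 S CV)^H u])); apply=> // q [z z1 qE] _ ->.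
  by rewrite -adjointP (T22_gens z1 qE) adjointP adjointK Su// inner0r.
apply: inner_injr => y; rewrite inner0r adjointPr.
have [p pE] := cs_lift (@gen_D z y z1).
have <- : T22 S CV (p, y) = (S z)^H y by exact: T22_gens.
by rewrite adjointP T22u inner0r.
Qed.

(** The adjoint of the transfer function at z sends y to S(0)^H y + B^H (gen z y), so a realization
    prescribes B^H on the generators exactly as [is_CV] prescribes [CV]. *)
Lemma realizesP (B : 'L(U, hpow d X)) :
  realizes S A B C (S 0) <-> B^H \oc cs_incl (space_D C A) = CV.
Proof.
have transfer z y : unit_ball z ->
    (S 0 + C \oc resolvent z \oc Zop X z \oc B)^H y = (S 0)^H y + B^H (gen z y).
  by move=> z1; rewrite adjointD !adjoint_comp.
have CVgen z y (p : space_D C A) : unit_ball z -> val p = gen z y ->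
    CV p = (S z)^H y - (S 0)^H y.
  by move=> z1 pE; rewrite (CVP z1 (y := y)) ?genE.
split=> [BS|BCV z z1].
  apply/eqP; rewrite -subr_eq0; apply/eqP/bopP_eq => p.
  have : cs_set (cspan [set q : space_D C A | exists z y, unit_ball z /\ val q =
    ((Zop X z)^H \oc bop_inv (bop_id - (col_op A)^H \oc (Zop X z)^H) \oc C^H) y]) p.
    by rewrite cspan_lift.
  apply: (@cspan_sub _ _ _ (bop_ker (B^H \oc cs_incl (space_D C A) - CV))).
  move=> {}p [z [y [z1]]]; rewrite genE// => pE.
  suff : B^H (val p) - CV p = 0 by [].
  have e : (S z)^H y = (S 0)^H y + B^H (gen z y).
    rewrite -transfer//; exact: (congr1 (fun F : 'L(U, Y) => F^H y) (BS z z1)).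
  by rewrite (CVgen z y)// pE e addrAC subrr add0r subrr.
rewrite -[S z]adjointK -[RHS]adjointK; congr adjoint; apply: bopP_eq => y.
rewrite [RHS]transfer//; have [p pE] := cs_lift (@gen_D z y z1).
have := CVgen z y p z1 pE; rewrite -BCV bop_compE cs_inclE pE => ->.
by rewrite addrC subrK.
Qed.

End colligation_theory.

(** * The colligation in the coordinates D^perp + (D + Y) *)

Section block_form.
Variables (R : realType) (d : nat) (U Y X : hilbertType R).
Variables (A : 'I_d -> 'L(X, X)) (C : 'L(X, Y)).

Let D := space_D C A.
Let Dp := space_Dperp C A.

Definition split_D : 'L(hsum (hpow d X) Y, hsum Dp (hsum D Y)) :=
  pair_op (bop_proj Dp \oc fst_op (hpow d X) Y)
    (pair_op (bop_proj D \oc fst_op (hpow d X) Y) (snd_op (hpow d X) Y)).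

Lemma split_DE p : split_D p = (bop_proj Dp p.1, (bop_proj D p.1, p.2)).
Proof.
rewrite -[LHS]/(bop_proj Dp (fst_op _ _ p), (bop_proj D (fst_op _ _ p), snd_op _ _ p)).
by rewrite fst_opE snd_opE.
Qed.

Lemma split_D_unitary : unitary split_D.
Proof.
apply: isometric_surj_unitary => [p|[g [p y]]].
  apply/norm_eq_inner; rewrite split_DE !hsum_innerE /= addrA.
  by rewrite proj_orth_norm.
exists (val g + val p, y); rewrite split_DE /=; congr (_, (_, _)).
  rewrite bopD [bop_proj Dp (val p)]bop_proj_orth0 ?addr0; last first.
    by move=> x xD; rewrite inner_conj xD ?rmorph0//; exact: cs_mem.
  by apply: val_inj; rewrite bop_proj_val//; exact: cs_mem.
rewrite bopD [bop_proj D (val g)]bop_proj_orth0 ?add0r; last exact: cs_mem.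
by apply: val_inj; rewrite bop_proj_val//; exact: cs_mem.
Qed.

Variables (S : 'rV[R[i]]_d -> 'L(U, Y)) (CV : 'L(D, U)).

Lemma colligation_adjoint (B : 'L(U, hpow d X)) :
  B^H \oc cs_incl D = CV -> (colligation A B C (S 0))^H
  = block_op (T11 C A) (T12 C A) (B^H \oc cs_incl Dp) (T22 S CV) \oc split_D.
Proof.
move=> BCV; rewrite /colligation block_adjoint; apply: bopP_eq => -[p y].
rewrite bop_compE split_DE.
have BCVx (q : D) : CV q = B^H (val q) by rewrite -BCV.
set g := bop_proj Dp p; set q := bop_proj D p.
have pE : p = val g + val q by rewrite proj_orth_split.
rewrite -[LHS]/((col_op A)^H p + C^H y, B^H p + (S 0)^H y).
rewrite -[RHS]/((col_op A)^H (val g) + ((col_op A)^H (val q) + C^H y),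
  B^H (val g) + (CV q + (S 0)^H y)).
by rewrite BCVx !addrA -!bopD -pE.
Qed.

Lemma B_ofE (G1 : 'L(cran (defect1 C A), Dp)) (G2 : 'L(cran (defect2 C A), U))
    (Q : 'L(cran (defect3 G1), null_inputs S)) (B : 'L(U, hpow d X)) :
  B = B_of CV G2 Q <->
  B^H \oc cs_incl D = CV /\ B^H \oc cs_incl Dp = X_of G2 Q.
Proof.
split=> [->|[BD BDp]].
  rewrite /B_of adjointD !adjoint_comp !adjointK; split.
    rewrite bop_compDl -!bop_compA [X in _ + _ \oc X]bop_proj_incl bop_comp1r.
    have -> : (cs_incl Dp)^H \oc cs_incl D = 0; last by rewrite bop_comp0r add0r.
    by rewrite -[RHS]adjoint0 -(@proj_orth_incl _ _ D) adjoint_comp adjointK.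
  rewrite bop_compDl -!bop_compA [X in _ \oc X + _]bop_proj_incl bop_comp1r.
  by rewrite [X in _ + _ \oc X]proj_orth_incl bop_comp0r addr0.
apply: bopP_eq => u; rewrite /B_of -BD -BDp !adjoint_comp !adjointK.
by rewrite bop_addE !bop_compE !cs_inclE proj_orth_split.
Qed.

End block_form.

(** * Description of the realizations *)

Theorem theorem2p7 (R : realType) (d : nat) (U Y X : hilbertType R)
  (S : 'rV[R[i]]_d -> 'L(U, Y)) (C : 'L(X, Y)) (A : 'I_d -> 'L(X, X))
  (S_schur : schur_class S)
  (CA_contractive : contractive_pair C A)
  (kernelE : forall l z, unit_ball l -> unit_ball z ->
    kernel_S S l z = kernel_CA C A l z)
  (CV : 'L(space_D C A, U)) (CVP : is_CV S CV)
  (G1 : 'L(cran (defect1 C A), space_Dperp C A)) (G1P : is_G1 G1)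
  (G2 : 'L(cran (defect2 C A), U)) (G2P : is_G2 S CV G2) :
  [/\ forall B : 'L(U, hpow d X), realizes S A B C (S 0) ->
        (weakly_coisometric C A (colligation A B C (S 0)) <->
         exists2 Q : 'L(cran (defect3 G1), null_inputs S),
           contractive Q & B = B_of CV G2 Q),
      ((exists2 B : 'L(U, hpow d X), realizes S A B C (S 0) &
          coisometric (colligation A B C (S 0))) <->
       dim_le (cran (defect3 G1)) (null_inputs S)) /\
      (dim_le (cran (defect3 G1)) (null_inputs S) ->
       forall B : 'L(U, hpow d X), realizes S A B C (S 0) ->
         (coisometric (colligation A B C (S 0)) <->
          exists2 Q : 'L(cran (defect3 G1), null_inputs S),
            isometric Q & B = B_of CV G2 Q))
    & ((exists2 B : 'L(U, hpow d X), realizes S A B C (S 0) &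
          unitary (colligation A B C (S 0))) <->
       isometric_pair C A /\
       dim_eq (cs_cap (bop_ker (col_op A)^H) (space_Dperp C A)) (null_inputs S)) /\
      (isometric_pair C A /\
       dim_eq (cs_cap (bop_ker (col_op A)^H) (space_Dperp C A)) (null_inputs S) ->
       forall B : 'L(U, hpow d X), realizes S A B C (S 0) ->
         (unitary (colligation A B C (S 0)) <->
          exists2 Q : 'L(cran (defect3 G1), null_inputs S),
            unitary Q & B = B_of CV G2 Q))].
Proof.
have col := column_isometric CA_contractive kernelE CVP.
have row x : inner ((T11 C A)^H x) ((T11 C A)^H x)
    + inner ((T12 C A)^H x) ((T12 C A)^H x) <= inner x x.
  by rewrite row_norm; exact: contractive_pairP.
have rowi : isometric_pair C A -> forall x, inner ((T11 C A)^H x) ((T11 C A)^H x)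
    + inner ((T12 C A)^H x) ((T12 C A)^H x) = inner x x.
  by move=> /isometric_pairP gi x; rewrite row_norm.
have [_ G2E] := G2P.
have NP := null_inputsP CA_contractive CVP.
pose M (B : 'L(U, hpow d X)) := block_op (T11 C A) (T12 C A)
  (B^H \oc cs_incl (space_Dperp C A)) (T22 S CV).
have real B := realizesP CA_contractive CVP B.
have UE B : realizes S A B C (S 0) ->
    (colligation A B C (S 0))^H = M B \oc split_D A C.
  by move=> /real; exact: colligation_adjoint.
have splitU := split_D_unitary A C.
have BE B (Q : 'L(cran (defect3 G1), null_inputs S)) : realizes S A B C (S 0) ->
    B^H \oc cs_incl (space_Dperp C A) = X_of G2 Q <-> B = B_of CV G2 Q.
  by move=> /real BCV; split=> [BX|/(B_ofE CV G2 Q B)[]//]; apply/B_ofE.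
have B_of_real (Q : 'L(cran (defect3 G1), null_inputs S)) :
    realizes S A (B_of CV G2 Q) C (S 0).
  by apply/real; exact: ((B_ofE CV G2 Q _).1 erefl).1.
have contP B : realizes S A B C (S 0) ->
    contractive (colligation A B C (S 0))^H <->
    exists2 Q : 'L(cran (defect3 G1), null_inputs S), contractive Q & B = B_of CV G2 Q.
  move=> Br; rewrite UE//; split.
    move=> /(contractive_comp_unitary _ splitU).
    move=> /(contractive_completionP col row G1P G2E NP)[Q Qc BX].
    by exists Q => //; apply/(BE B Q Br).
  move=> [Q Qc /(BE B Q Br) BX]; apply/(contractive_comp_unitary _ splitU).
  by apply/(contractive_completionP col row G1P G2E NP); exists Q.
have coisoP B : realizes S A B C (S 0) ->
    coisometric (colligation A B C (S 0)) <->
    exists2 Q : 'L(cran (defect3 G1), null_inputs S), isometric Q & B = B_of CV G2 Q.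
  move=> Br; rewrite /coisometric UE//; split.
    move=> /(isometric_comp_unitary _ splitU).
    move=> /(isometric_completionP col row G1P G2E NP)[Q Qc BX].
    by exists Q => //; apply/(BE B Q Br).
  move=> [Q Qc /(BE B Q Br) BX]; apply/(isometric_comp_unitary _ splitU).
  by apply/(isometric_completionP col row G1P G2E NP); exists Q.
have unitP B : realizes S A B C (S 0) -> isometric_pair C A ->
    unitary (colligation A B C (S 0)) <->
    exists2 Q : 'L(cran (defect3 G1), null_inputs S), unitary Q & B = B_of CV G2 Q.
  move=> Br iCA; have iso (Q : 'L(cran (defect3 G1), null_inputs S)) :
      isometric Q -> B = B_of CV G2 Q ->
      isometric (colligation A B C (S 0)) <-> coisometric Q.
    move=> Qi /(BE B Q Br) BX.
    have := coisometric_completionP col row G1P G2E NP (rowi iCA) Qi.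
    (* A colligation is isometric when its adjoint is coisometric, which moves the question to the
       completion [M B]. *)
    have -> : isometric (colligation A B C (S 0)) <-> coisometric (M B).
      rewrite -(coisometric_comp_unitary (M B) splitU) -UE// /coisometric.
      by rewrite adjointK.
    by rewrite /M BX.
  split=> [[Ui /(coisoP B Br)[Q Qi BQ]]|[Q [Qi Qc] BQ]].
    by exists Q => //; split=> //; apply/(iso Q).
  by split; [apply/(iso Q)|apply/coisoP => //; exists Q].
(* On vectors [(x, 0)] an isometric colligation says |A x|^2 + |C x|^2 = |x|^2. *)
have unit_iso B : isometric (colligation A B C (S 0)) -> isometric_pair C A.
  move=> Ui; apply/isometric_pairP => x; have /norm_eq_inner := Ui (x, 0).
  rewrite !hsum_innerE /= !bop0 !addr0 inner0l addr0; exact.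
have kerU : isometric_pair C A -> exists J : 'L(
    cs_cap (bop_ker (col_op A)^H) (space_Dperp C A), cran (defect3 G1)), unitary J.
  move=> iCA; apply: nested_csubspace_unitary => [x []//|x].
  have := cran_defect3 col row G1P (rowi iCA) x => xP.
  split=> [/xP|[/= Ax _]]; last exact/xP.
  by move=> T11x; split; [exact: T11x|exact: cs_mem].
split.
- move=> B Br; split=> [[/(contP B Br)]//|BQ].
  split; first exact/contP.
  (* For a realization, isometry on D + Y is automatic: B^H is [CV] on D, so the adjoint acts there
     as the isometric column. *)
  move=> p y /cs_lift[q qp]; apply/norm_eq_inner.
  have /real BCV := Br; rewrite /colligation block_adjoint -qp.
  by have := col (q, y); rewrite -BCV.
- split=> [|_ B Br]; last exact: coisoP.
  split=> [[B Br /(coisoP B Br)[Q Qi _]]|/dim_leP[Q Qi]].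
    by apply/dim_leP; exists Q.
  (* Any [Q] produces a realization, so the isometry supplied by the dimensions can be used
     directly. *)
  by exists (B_of CV G2 Q) => //; apply/coisoP => //; exists Q.
split=> [|[iCA _] B Br]; last exact: unitP.
split=> [[B Br BU]|[iCA /dim_eqP[V VU]]].
  have iCA := unit_iso B BU.1; split=> //.
  have /(unitP B Br iCA)[Q QU _] := BU.
  have [J JU] := kerU iCA.
  by apply/dim_eqP; exists (Q \oc J); exact: unitary_comp.
have [J JU] := kerU iCA.
(* The dimension condition speaks of Ker A^H in D^perp; [J^H] carries the range of the last defect
   operator there. *)
have VJU : unitary (V \oc J^H) by apply: unitary_comp VU (unitary_adjoint JU).
exists (B_of CV G2 (V \oc J^H)) => //; apply/unitP => //.
by exists (V \oc J^H).
Qed.
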